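(* Let $K:[0,1]\times[0,1]\to\mathbb R$ be a measurable function with $K(0,r)=0$ for every $r\in[0,1]$, and suppose there exist a strictly increasing continuous function $\mathcal G:[0,1]\to\mathbb R$ and a constant $\alpha>0$ such that $$\int_0^1 (K(t,r)-K(s,r))^2\,dr\le (\mathcal G(t)-\mathcal G(s))^{\alpha}\qquad\text{for all }0\le s<t\le 1 .$$ For $\epsilon>0$ let $G_\epsilon(t)=\int_0^1 K(t,r)\theta_\epsilon(r)\,dr$, $0\le t\le 1$, where $\theta_\epsilon(r)=\frac1\epsilon(-1)^{N(\epsilon^{-2}r)}$ and $N$ is a standard Poisson process. Then the family $\{\epsilon G_\epsilon(\cdot),\epsilon>0\}$ satisfies the large deviation principle in $C([0,1])$ as $\epsilon\to0$ with speed $\epsilon^2$ and rate function $I$ defined for $f\in C([0,1])$ by $$I(f)=\inf\left\{\int_0^1\Lambda^*(\phi(r))\,dr:\ \phi\in L^2([0,1]),\ f(t)=\int_0^1K(t,r)\phi(r)\,dr\ \text{ for all } t\in[0,1]\right\},$$ where $\Lambda^*(x)=1-\sqrt{1-x^2}$ for $|x|\le1$ and $\Lambda^*(x)=+\infty$ for $|x|>1$. Explicitly, for every Borel measurable set $A\subseteq C([0,1])$, $$-\inf_{f\in A^\circ}I(f)\le\liminf_{\epsilon\to0}\epsilon^2\log\mathbb P(\epsilon G_\epsilon(\cdot)\in A)\le\limsup_{\epsilon\to0}\epsilon^2\log\mathbb P(\epsilon G_\epsilon(\cdot)\in A)\le-\inf_{f\in\overline A}I(f).$$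
   Context: A standard Poisson process $N=\{N(t),t\ge0\}$ has rate $1$ and $N(0)=0$. $C([0,1])$ is the space of continuous functions $[0,1]\to\mathbb R$ with the uniform topology. $A^\circ$ and $\overline A$ denote interior and closure. Conventions: $\inf\emptyset=+\infty$, $\log0=-\infty$. A rate function is a lower semicontinuous map with values in $[0,+\infty]$. A family $(Z_\epsilon)_{\epsilon>0}$ of random variables in a topological space $S$ satisfies the large deviation principle as $\epsilon\to0$ with speed $a(\epsilon)$ and rate function $I$ if for every Borel $A\subseteq S$: $-\inf_{A^\circ}I\le\liminf_{\epsilon\to0}a(\epsilon)\log\mathbb P(Z_\epsilon\in A)\le\limsup_{\epsilon\to0}a(\epsilon)\log\mathbb P(Z_\epsilon\in A)\le-\inf_{\overline A}I$. *)

(* Defs.v *)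
From HB Require Import structures.
From mathcomp Require Import all_boot all_order all_algebra.
From mathcomp Require Import all_classical all_reals all_analysis.

Set Implicit Arguments.
Unset Strict Implicit.
Unset Printing Implicit Defensive.

Import Order.TTheory GRing.Theory Num.Theory.
Import numFieldNormedType.Exports.

Local Open Scope classical_set_scope.
Local Open Scope ring_scope.

(* The domain [0,1] is a type of its own (the set, coerced to its sigma type),
   so that two elements of C([0,1]) agreeing on [0,1] are equal. *)
Definition C01 (R : realType) : Type :=
  continuousType (set_type (`[0, 1]%classic : set R)) R.

Definition C01_fun (R : realType) (f : C01 R) :
  arrow_uniform_type (set_type (`[0, 1]%classic : set R)) R := f.

#[warnings="-redundant-canonical-projection"]
HB.instance Definition _ (R : realType) :=
  PseudoMetric.copy (C01 R) (initial_topology (@C01_fun R)).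

Definition borel (S : topologicalType) : set (set S) := <<s @open S >>.

Definition rate_function (R : realType) (S : topologicalType)
    (I : S -> \bar R) : Prop :=
  lower_semicontinuous I /\ forall x, (0 <= I x)%E.

(* [0^'+] is the filter of right neighbourhoods of 0, i.e. [eps -> 0] through
   positive values; [lne] satisfies [lne 0 = -oo] and [ereal_inf set0 = +oo]. *)
Definition large_deviation_principle (R : realType) (d : measure_display)
    (T : measurableType d) (P : probability T R) (S : topologicalType)
    (Z : R -> T -> S) (speed : R -> R) (I : S -> \bar R) : Prop :=
  let scaled_log (A : set S) (eps : R) : \bar R :=
    ((speed eps)%:E * lne (P (Z eps @^-1` A)))%E in
  [/\ rate_function I,
      forall eps : R, 0 < eps ->
        forall A : set S, borel A -> measurable (Z eps @^-1` A)
    & forall A : set S, borel A ->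
      [/\ (- ereal_inf (I @` A°) <= limf_einf (scaled_log A) 0^'+)%E,
          (limf_einf (scaled_log A) 0^'+ <= limf_esup (scaled_log A) 0^'+)%E
        & (limf_esup (scaled_log A) 0^'+ <= - ereal_inf (I @` closure A))%E]].

(* Allowing [B i = setT] makes the full product rule imply the product rule
   over every subfamily. *)
Definition mutually_independent (R : realType) (d d' : measure_display)
    (T : measurableType d) (T' : measurableType d') (P : probability T R)
    (n : nat) (X : 'I_n -> T -> T') : Prop :=
  forall B : 'I_n -> set T', (forall i, measurable (B i)) ->
    P (\bigcap_i (X i @^-1` B i)) = (\prod_(i < n) P (X i @^-1` B i))%E.

(* [N t] is only constrained for [t >= 0]; the truncated subtraction is the
   genuine increment because the paths are nondecreasing. *)
Record standard_poisson_process (R : realType) (d : measure_display)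
    (T : measurableType d) (P : probability T R) (N : R -> T -> nat) : Prop :=
  StandardPoissonProcess {
    poisson_measurable : forall t : R, 0 <= t -> measurable_fun setT (N t);
    poisson_start : forall w : T, N 0 w = 0%N;
    poisson_nondecreasing : forall (w : T) (s t : R),
      0 <= s -> s <= t -> (N s w <= N t w)%N;
    poisson_right_continuous : forall (w : T) (t : R), 0 <= t ->
      \forall s \near t^'+, N s w = N t w;
    poisson_independent_increments : forall (n : nat) (t : nat -> R),
      0 <= t 0%N -> {homo t : i j / (i <= j)%N >-> i <= j} ->
      mutually_independent P
        (fun (i : 'I_n) (w : T) => (N (t i.+1) w - N (t i) w)%N);
    poisson_increment_law : forall s t : R, 0 <= s -> s < t ->
      forall k : nat,
        P [set w | (N t w - N s w)%N = k] = (poisson_pmf (t - s) k)%:E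
  }.

Section kac_stroock.
Context {R : realType}.
Notation mu := (@lebesgue_measure R).

Definition theta {T : Type} (N : R -> T -> nat) (eps r : R) (w : T) : R :=
  eps^-1 * (-1) ^+ N (eps ^- 2 * r) w.

Definition G_process {T : Type} (K : R -> R -> R) (N : R -> T -> nat)
    (eps t : R) (w : T) : R :=
  \int[mu]_(r in `[0, 1]) (K t r * theta N eps r w).

Definition Lambda_star (x : R) : \bar R :=
  if `|x| <= 1 then (1 - Num.sqrt (1 - x ^+ 2))%:E else +oo%E.

Definition L2_01 : set (R -> R) :=
  [set phi : R -> R | measurable_fun (`[0, 1] : set R) phi /\
    (\int[mu]_(r in `[0%R, 1%R]) ((phi r) ^+ 2)%:E < +oo)%E].

Definition rate_I (K : R -> R -> R) (f : C01 R) : \bar R :=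
  ereal_inf [set (\int[mu]_(r in `[0%R, 1%R]) Lambda_star (phi r))%E
    | phi in [set phi : R -> R | L2_01 phi /\
        forall t : set_type (`[0, 1]%classic : set R),
          f t = \int[mu]_(r in `[0, 1]) (K (\val t) r * phi r)]].

End kac_stroock.

(* Main.v *)
Require Import Defs.
From HB Require Import structures.
From mathcomp Require Import all_boot all_order all_algebra.
From mathcomp Require Import all_classical all_reals all_analysis.
From mathcomp Require Import measurable_realfun ring lra.
Import Order.TTheory GRing.Theory Num.Theory.
Import numFieldNormedType.Exports.
Local Open Scope classical_set_scope.
Local Open Scope ring_scope.

Set Implicit Arguments.
Unset Strict Implicit.
Unset Printing Implicit Defensive.

(* Put [X r = (-1) ^ N (r / eps^2)]; then [eps G_eps = K X], where [K phi] is
   the function [t |-> \int K(t,r) phi(r) dr], and [|X| <= 1]. On the unit ball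
   of L^oo the image [K phi] is determined in C([0,1]), up to a small error, by
   the averages of [phi] over finitely many cells, so only the joint law of the
   integrals of [X] over the cells matters. Since [X] is a two-state Markov
   chain, the Perron eigenvector of its tilted generator shows that the moment
   generating function of these integrals, with tilt [tau l_i] on cell [i] and
   [tau = eps^-2], is [exp (tau / n * \sum_i Lam (l_i))] up to constants
   independent of [tau], where [Lam l = sqrt (1 + l^2) - 1] is the convex dual
   of [Lambda_star]. Chernoff's inequality over a finite grid of tilts gives the
   upper bound for the cell integrals; comparing the moment generating function
   at the optimal tilt with slightly perturbed tilts gives the lower bound.
   Jensen's inequality, weak compactness of the unit ball and lower
   semicontinuity of [phi |-> \int Lambda_star (phi)] carry both bounds over to
   C([0,1]). *)

(** * The Legendre pair *)

(** What has to be arranged is uniformity in [tau]. The continuous-time signal is sampled at [m]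
    points per cell, and [m] tends to infinity before [tau] does: the flip probability over a time
    [h] is known up to [h^2], and the accumulated error, of order [tau * h], vanishes with the mesh.
    What survives is a factor that depends on the tilts alone, due to the change of eigenvector
    between consecutive cells; [eps^2] times its logarithm tends to 0. The number of cells is chosen
    first, from the set under study, and stays fixed as [eps] tends to 0. The optimal tilt
    [x / sqrt (1 - x^2)] blows up as |x| tends to 1, although [Lambda_star] stays bounded on
    [-1, 1]. This is why points are shrunk by a factor slightly below 1 before a tilt is chosen,
    both for the finite grid and in the lower bound. The kernel enters through the continuity of
    [t |-> K(t, .)] into L^1. Together with the compactness of [0,1], it turns weak convergence in
    the unit ball into uniform convergence of [K phi]. *)

Section legendre.
Context {R : realType}.
Implicit Types x y l k : R.

Definition Lam l : R := Num.sqrt (1 + l ^+ 2) - 1.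
(* [Lst] is the finite branch of [Lambda_star]; outside [-1, 1] it takes the
   junk value [1], since [Num.sqrt] vanishes on negative numbers. *)
Definition Lst x : R := 1 - Num.sqrt (1 - x ^+ 2).

Lemma Lst_ge0 x : 0 <= Lst x.
Proof.
rewrite subr_ge0 -[leRHS]sqrtr1 ler_sqrt ?ler01// gerBl.
exact: sqr_ge0.
Qed.

Lemma Lst_le1 x : Lst x <= 1.
Proof. by rewrite gerBl sqrtr_ge0. Qed.

Lemma ler_Lst x y : `|x| <= `|y| -> Lst x <= Lst y.
Proof.
move=> xy; rewrite lerB//; apply: ler_wsqrtr; rewrite lerB//.
by rewrite -[x ^+ 2]real_normK ?num_real// -[y ^+ 2]real_normK ?num_real//
  lerXn2r// nnegrE.
Qed.

(** Cauchy-Schwarz for the vectors [(l, 1)] and [(x, sqrt (1 - x^2))], the second of which has norm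
    1; the two squares in the proof add up to [1 + l^2] by Lagrange's identity. *)
Lemma Lam_young l x : `|x| <= 1 -> l * x - Lam l <= Lst x.
Proof.
move=> x1; rewrite /Lam /Lst.
have x2 : 0 <= 1 - x ^+ 2.
  by rewrite subr_ge0 -[x ^+ 2]real_normK ?num_real// exprn_ile1.
have l2 : 0 <= 1 + l ^+ 2 by rewrite addr_ge0// sqr_ge0.
suff : l * x + Num.sqrt (1 - x ^+ 2) <= Num.sqrt (1 + l ^+ 2) by lra.
set s := Num.sqrt (1 - x ^+ 2); set t := Num.sqrt (1 + l ^+ 2).
have s0 : 0 <= s by exact: sqrtr_ge0.
have t0 : 0 <= t by exact: sqrtr_ge0.
have s2 : s ^+ 2 = 1 - x ^+ 2 by rewrite sqr_sqrtr.
have t2 : t ^+ 2 = 1 + l ^+ 2 by rewrite sqr_sqrtr.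
rewrite leNgt; apply/negP => h.
have : t ^+ 2 < (l * x + s) ^+ 2 by rewrite ltrXn2r// ?nnegrE//; lra.
have : 0 <= (l * s - x) ^+ 2 by exact: sqr_ge0.
have -> : (l * s - x) ^+ 2 = l ^+ 2 * s ^+ 2 - 2 * l * s * x + x ^+ 2 by ring.
have -> : (l * x + s) ^+ 2 = l ^+ 2 * x ^+ 2 + 2 * l * s * x + s ^+ 2 by ring.
by rewrite s2 t2 => A B; nra.
Qed.

(* The derivative of [Lst], i.e. the tilt under which the mean is [x]. *)
Definition slope x : R := x / Num.sqrt (1 - x ^+ 2).

(** For [x = sin a] one has [slope x = tan a] and [s = 1 / cos a]. Passing to [s] removes the square
    roots, so that identities at an optimal tilt become rational in [s]. *)
Lemma slope_spec x : `|x| < 1 ->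
  exists s, [/\ 1 <= s, s ^+ 2 = 1 + slope x ^+ 2, Lam (slope x) = s - 1,
                x = slope x / s & Lst x = 1 - s^-1].
Proof.
move=> x1.
have x2 : 0 < 1 - x ^+ 2.
  by rewrite subr_gt0 -[x ^+ 2]real_normK ?num_real// exprn_ilt1.
set r := Num.sqrt (1 - x ^+ 2).
have r0 : 0 < r by rewrite sqrtr_gt0.
have r2 : r ^+ 2 = 1 - x ^+ 2 by rewrite sqr_sqrtr// ltW.
have r1 : r <= 1.
  by rewrite -[leRHS]sqrtr1 ler_sqrt ?ler01// gerBl sqr_ge0.
have E : r^-1 ^+ 2 = 1 + slope x ^+ 2.
  rewrite /slope -/r exprMn exprVn r2.
  by field; rewrite gt_eqF.
exists r^-1; split => //.
- by rewrite invf_ge1.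
- by rewrite /Lam -E sqrtr_sqr ger0_norm// invr_ge0 ltW.
- by rewrite /slope -/r invrK divfK// gt_eqF.
- by rewrite invrK.
Qed.

Lemma Lam_dual x : `|x| < 1 -> slope x * x - Lam (slope x) = Lst x.
Proof.
move=> /slope_spec[s [s1 s2 -> xE ->]].
have s0 : s != 0 by rewrite gt_eqF//; lra.
rewrite {2}xE mulrA -expr2.
have -> : slope x ^+ 2 = s ^+ 2 - 1 by lra.
by field.
Qed.

(** Second-order Taylor bound: [Lam' (slope x) = x] and [Lam'' <= 1]. The proof uses
    [sqrt (s^2 + u) <= s + u / (2 s)] with [u = 2 k l + k^2], then [1 <= s]. *)
Lemma Lam_slopeD x k : `|x| < 1 ->
  Lam (slope x + k) <= Lam (slope x) + k * x + k ^+ 2 / 2.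
Proof.
move=> /slope_spec[s [s1 s2 -> xE _]].
rewrite /Lam.
have s0 : 0 < s by lra.
suff : Num.sqrt (1 + (slope x + k) ^+ 2) <= s + k * x + k ^+ 2 / 2 by lra.
have xs : x * s = slope x by rewrite {1}xE divfK// gt_eqF.
set l := slope x in s2 xs *.
have -> : s + k * x + k ^+ 2 / 2 = (2 * s ^+ 2 + 2 * k * l + k ^+ 2 * s) / (2 * s).
  by rewrite -xs; field; rewrite gt_eqF.
have B : 0 <= 2 * s ^+ 2 + 2 * k * l + k ^+ 2.
  by rewrite s2; have := sqr_ge0 (k + l); have := sqr_ge0 l; nra.
have C : 2 * s ^+ 2 + 2 * k * l + k ^+ 2 <= 2 * s ^+ 2 + 2 * k * l + k ^+ 2 * s.
  by have := sqr_ge0 k; nra.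
rewrite ler_pdivlMr; last lra.
rewrite -(ler_pXn2r (n := 2)) ?nnegrE//; last 2 first.
- by rewrite mulr_ge0 ?sqrtr_ge0//; lra.
- exact: le_trans B C.
apply: (@le_trans _ _ ((2 * s ^+ 2 + 2 * k * l + k ^+ 2) ^+ 2)); last first.
  by rewrite ler_pXn2r ?nnegrE//; exact: le_trans B C.
rewrite exprMn sqr_sqrtr; last by rewrite addr_ge0// sqr_ge0.
have -> : 1 + (l + k) ^+ 2 = s ^+ 2 + (2 * k * l + k ^+ 2) by rewrite s2; ring.
have -> : (2 * s ^+ 2 + 2 * k * l + k ^+ 2) ^+ 2 =
  (s ^+ 2 + (2 * k * l + k ^+ 2)) * (2 * s) ^+ 2 + (2 * k * l + k ^+ 2) ^+ 2 by ring.
by rewrite lerDl sqr_ge0.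
Qed.

Lemma Lam_ge0 l : 0 <= Lam l.
Proof. by rewrite subr_ge0 -{1}[1]sqrtr1 ler_wsqrtr// lerDl sqr_ge0. Qed.

Lemma Lam_lip l k : Lam k <= Lam l + `|k - l|.
Proof.
rewrite /Lam.
suff : Num.sqrt (1 + k ^+ 2) <= Num.sqrt (1 + l ^+ 2) + `|k - l| by lra.
have l2 : 0 <= 1 + l ^+ 2 by rewrite addr_ge0// sqr_ge0.
have ls : `|l| <= Num.sqrt (1 + l ^+ 2).
  by rewrite -sqrtr_sqr ler_wsqrtr// lerDr.
set t := Num.sqrt (1 + l ^+ 2) in ls *.
have t0 : 0 <= t by exact: sqrtr_ge0.
rewrite -(ler_pXn2r (n := 2)) ?nnegrE ?sqrtr_ge0 ?addr_ge0//.
rewrite sqr_sqrtr; last by rewrite addr_ge0// sqr_ge0.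
rewrite sqrrD sqr_sqrtr// real_normK ?num_real//.
have : l * (k - l) <= t * `|k - l|.
  by rewrite (le_trans (ler_norm _))// normrM ler_wpM2r.
by rewrite mulr2n; nra.
Qed.

(** Subadditivity of the square root. The loss is uniform up to |x| = 1, where the slope of [Lst] is
    infinite. *)
Lemma Lst_shrink x d : `|x| <= 1 -> 0 <= d <= 1 ->
  Lst x <= Lst ((1 - d) * x) + Num.sqrt (2 * d).
Proof.
move=> x1 /andP[d0 d1]; rewrite /Lst.
have x2 : x ^+ 2 <= 1 by rewrite -[x ^+ 2]real_normK ?num_real// exprn_ile1.
have x20 := sqr_ge0 x.
have E : 1 - ((1 - d) * x) ^+ 2 = 1 - x ^+ 2 + (2 * d - d ^+ 2) * x ^+ 2 by ring.
have A : 0 <= 1 - x ^+ 2 by lra.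
have d2 : 0 <= 2 * d - d ^+ 2 by nra.
have : Num.sqrt (1 - ((1 - d) * x) ^+ 2) <=
    Num.sqrt (1 - x ^+ 2) + Num.sqrt (2 * d).
  rewrite -(ler_pXn2r (n := 2)) ?nnegrE ?sqrtr_ge0 ?addr_ge0 ?sqrtr_ge0//.
  rewrite sqr_sqrtr; last by rewrite E addr_ge0// mulr_ge0.
  rewrite sqrrD !sqr_sqrtr//; last lra.
  have : 0 <= Num.sqrt (1 - x ^+ 2) * Num.sqrt (2 * d).
    by rewrite mulr_ge0 ?sqrtr_ge0.
  by rewrite E mulr2n; nra.
by lra.
Qed.

Lemma slope_le x d : `|x| <= 1 - d -> 0 < d -> `|slope x| <= d^-1.
Proof.
move=> xd d0; rewrite /slope normrM normfV (ger0_norm (sqrtr_ge0 _)).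
have x0 := normr_ge0 x.
have dr : d <= Num.sqrt (1 - x ^+ 2).
  rewrite -[X in X <= _](ger0_norm (ltW d0)) -sqrtr_sqr ler_wsqrtr//.
  by rewrite -[x ^+ 2]real_normK ?num_real//; nra.
apply: (@le_trans _ _ (1 * d^-1)); last by rewrite mul1r.
rewrite ler_pM ?invr_ge0 ?sqrtr_ge0//; first lra.
by rewrite lef_pV2 ?posrE// (lt_le_trans d0 dr).
Qed.

(** The optimal tilt at [x] is unbounded near |x| = 1, but the optimal tilt at [(1 - d) * x] lies in
    [[- d^-1, d^-1]], which a finite mesh covers. *)
Lemma Lam_grid (e : R) : 0 < e -> exists q : seq R,
  forall x, `|x| <= 1 -> exists2 l, l \in q & Lst x - e <= l * x - Lam l.
Proof.
move=> e0.
have [d [d0 d1 dE]] : exists d : R, [/\ 0 < d, d <= 1 & Num.sqrt (2 * d) <= e / 2].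
  exists (Num.min 1 (e ^+ 2 / 8)); split.
  - by rewrite lt_min ltr01/= divr_gt0// exprn_gt0.
  - by rewrite ge_min lexx.
  - have -> : e / 2 = Num.sqrt ((e / 2) ^+ 2) by rewrite sqrtr_sqr ger0_norm//; lra.
    apply: ler_wsqrtr.
    have : Num.min 1 (e ^+ 2 / 8) <= e ^+ 2 / 8 by rewrite ge_min lexx orbT.
    by rewrite expr2; lra.
(* Error budget: [e / 2] for shrinking [x], then [h] for the change of [Lam] and [h] for the change
   of [l * x] when the tilt is rounded down to the mesh. *)
pose h := e / 4.
have h0 : 0 < h by rewrite /h; lra.
pose q := [seq j%:R * h - d^-1 | j <- iota 0 (Num.truncn (2 * d^-1 / h)).+1].
exists q => x x1.
set y := (1 - d) * x.
have yx : `|y| <= 1 - d.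
  by rewrite normrM ger0_norm ?subr_ge0// ler_piMr// subr_ge0.
have y1 : `|y| < 1 by rewrite (le_lt_trans yx)//; lra.
have dV : 0 < d^-1 by rewrite invr_gt0.
have := slope_le yx d0; set l := slope y; rewrite ler_norml => /andP[lm lM].
pose j := Num.truncn ((l + d^-1) / h).
have l0 : 0 <= (l + d^-1) / h by apply: divr_ge0; lra.
have /andP[k1 k2] := truncn_itv l0; rewrite -/j in k1 k2.
exists (j%:R * h - d^-1).
  apply/mapP; exists j => //; rewrite mem_iota/= add0n ltnS.
  by apply: le_truncn; rewrite ler_pM2r ?invr_gt0//; lra.
set l' := j%:R * h - d^-1.
have ll' : `|l' - l| <= h.
  move: k1 k2; rewrite ler_pdivlMr// ltr_pdivrMr// -natr1 mulrDl mul1r => k1 k2.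
  by rewrite /l' ler_norml; lra.
have L1 := Lam_lip l l'.
(* The tilt [l] has the sign of [x] and |y| <= |x|, so replacing [y] by [x] can only increase
   [l * y]. *)
have L2 : l * x - Lam l >= Lst y.
  rewrite -(Lam_dual y1) -/l.
  suff : l * y <= l * x by lra.
  rewrite /l /slope mulrAC [leRHS]mulrAC ler_wpM2r ?invr_ge0 ?sqrtr_ge0//.
  rewrite /y -mulrA [leRHS]mulrAC.
  by have := sqr_ge0 x; nra.
have L3 := Lst_shrink x1 (d := d).
have L4 : (l - l') * x <= h.
  rewrite (le_trans (ler_norm _))// normrM distrC -[leRHS]mulr1 ler_pM//.
have := L3 _; rewrite ltW// d1 => /(_ isT); rewrite -/y.
by move: dE L1 L2 L4 ll'; rewrite /h; lra.
Qed.

End legendre.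

(** * Cell integrals *)

Section integration.
Context {R : realType}.
Notation mu := (@lebesgue_measure R).
Implicit Types f g phi psi : R -> R.

Lemma mu01 : mu (`[0, 1]%classic : set R) = 1%E.
Proof. by rewrite lebesgue_measure_itv/= lte01 oppr0 adde0. Qed.

Lemma sub_mu01_fin (A : set R) : measurable A -> A `<=` `[0, 1] -> (mu A < +oo)%E.
Proof.
move=> mA A01; apply: (@le_lt_trans _ _ (mu (`[0, 1]%classic : set R))).
  by apply: le_measure => //; rewrite inE.
by rewrite mu01 ltry.
Qed.

Lemma bounded_integrable d (T : measurableType d) (nu : {measure set T -> \bar R})
    (D : set T) (f : T -> R) (M : R) : measurable D ->
  (nu D < +oo)%E -> measurable_fun D f -> (forall x, D x -> `|f x| <= M) ->
  nu.-integrable D (EFin \o f).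
Proof.
move=> mD D1 mf fM; apply: measurable_bounded_integrable => //.
exists M; split; first exact: num_real.
by move=> y My x Dx; rewrite /= (le_trans (fM _ Dx))// ltW.
Qed.

Definition unit_ball : set (R -> R) :=
  [set phi : R -> R | measurable_fun (`[0, 1] : set R) phi /\
             forall r, `[0, 1]%classic r -> `|phi r| <= 1].

Lemma unit_ball_integrable phi (A : set R) : unit_ball phi -> measurable A ->
  A `<=` `[0, 1] -> mu.-integrable A (EFin \o phi).
Proof.
move=> [mphi phi1] mA A01; apply: (@bounded_integrable _ _ _ _ _ 1) => //.
- exact: sub_mu01_fin.
- exact: measurable_funS mphi.
- by move=> x /A01; exact: phi1.
Qed.

Lemma integrableM_unit_ball f phi : unit_ball phi ->
  mu.-integrable `[0, 1] (EFin \o f) ->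
  mu.-integrable `[0, 1] (EFin \o (fun r => f r * phi r)).
Proof.
move=> [mphi phi1] /[dup] fi /integrableP[/measurable_EFinP mf _].
apply: (le_integrable _ _ _ fi) => //.
  by apply/measurable_EFinP; exact: measurable_funM.
move=> r r01 /=; rewrite lee_fin normrM ler_piMr//.
exact: phi1.
Qed.

Lemma le_RintegralM f phi : unit_ball phi ->
  mu.-integrable `[0, 1] (EFin \o f) ->
  `|\int[mu]_(r in `[0, 1]) (f r * phi r)| <= \int[mu]_(r in `[0, 1]) `|f r|.
Proof.
move=> ph fi; have fpi := integrableM_unit_ball ph fi.
apply: le_trans (le_normr_Rintegral _ _) _ => //.
apply: le_Rintegral => //.
- exact: (integrable_norm fpi).
- exact: (integrable_norm fi).
- by move=> r r01; rewrite normrM ler_piMr//; exact: ph.2.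
Qed.

Lemma Rintegral_chain f (a : nat -> R) n : nondecreasing_seq a ->
  mu.-integrable `[a 0%N, a n] (EFin \o f) ->
  \int[mu]_(r in `[a 0%N, a n]) f r =
  \sum_(i < n) \int[mu]_(r in `[a i, a i.+1]) f r.
Proof.
move=> nda; elim: n => [_|n IH fi]; first by rewrite big_ord0 set_itv1 Rintegral_set1.
have a0n : a 0%N <= a n by exact: nda.
have ann : a n <= a n.+1 by exact: nda.
rewrite big_ord_recr/= -IH; last first.
  by apply: integrableS fi => //; apply: subset_itvl; rewrite bnd_simp.
have := @Rintegral_itvB _ f (BLeft (a 0%N)) (BRight (a n.+1)) (a n) fi.
rewrite !bnd_simp => /(_ a0n ann).
rewrite Rintegral_itv_obnd_cbnd; last first.
  by apply: integrableS fi => //; apply: subset_itvr; rewrite bnd_simp.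
by move=> <-; rewrite addrC subrK.
Qed.

Definition cell_int n i phi : R :=
  \int[mu]_(r in `[i%:R / n%:R, i.+1%:R / n%:R]) phi r.

Lemma cell_sub n i : (i < n)%N -> `[i%:R / n%:R, i.+1%:R / n%:R] `<=` `[(0 : R), 1].
Proof.
move=> i_n; have n0 : 0 < n%:R :> R by rewrite ltr0n (leq_ltn_trans _ i_n).
move=> r /=; rewrite !in_itv/= => /andP[r0 r1]; apply/andP; split.
  by rewrite (le_trans _ r0)// divr_ge0.
by rewrite (le_trans r1)// ler_pdivrMr// mul1r ler_nat.
Qed.

Lemma cell_intE n f : (0 < n)%N -> mu.-integrable `[0, 1] (EFin \o f) ->
  \int[mu]_(r in `[0, 1]) f r = \sum_(i < n) cell_int n i f.
Proof.
move=> n0 fi; have n0' : n%:R != 0 :> R by rewrite pnatr_eq0 -lt0n.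
have := @Rintegral_chain f (fun i => i%:R / n%:R) n.
rewrite mul0r divff//; apply => //.
by move=> i j ij; rewrite ler_wpM2r// ler_nat.
Qed.

Lemma mu_cell n i : (0 < n)%N ->
  mu (`[i%:R / n%:R, i.+1%:R / n%:R]%classic : set R) = (n%:R^-1)%:E.
Proof.
move=> n0; rewrite lebesgue_measure_itv/= lte_fin ltr_pM2r ?invr_gt0 ?ltr0n//.
rewrite ltr_nat ltnSn -EFinD -mulrBl.
by rewrite -natrB// subSnn mul1r.
Qed.

Lemma continuous01_uniform g (e : R) : continuous g -> 0 < e ->
  exists2 d : R, 0 < d & forall x y, `[0, 1]%classic x -> `|x - y| < d -> `|g x - g y| < e.
Proof.
move=> cg e0.
have /compact_near_coveringP/near_covering_withinP := @segment_compact R 0 1.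
move=> /(_ R (0^'+) (fun d x => forall y, `|x - y| < d -> `|g x - g y| < e)).
move=> /(_ _ _)[].
  move=> x _; have /cvgrPdist_lt/(_ (e / 2)) := cg x.
  rewrite divr_gt0// => /(_ isT)/nbhs_ballP[d /= d0 H].
  exists (ball x (d / 2), [set y | y < d / 2]) => /=.
    split; first by apply: nbhsx_ballx; rewrite divr_gt0.
    by apply: nbhs_right_lt; rewrite divr_gt0.
  move=> [x' d'] /= [xx' d'd] _ y x'y.
  have A : `|g x - g x'| < e / 2.
    by apply: H; rewrite /ball/= (lt_le_trans xx')// ler_pdivrMr// ler_peMr ?ler1n// ltW.
  have B : `|g x - g y| < e / 2.
    apply: H; rewrite /ball/= (splitr d) (le_lt_trans (ler_distD x' _ _))// ltrD//.
    exact: lt_trans d'd.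
  rewrite distrC in A.
  by rewrite (splitr e) (le_lt_trans (ler_distD (g x) _ _))// ltrD.
move=> d /= d0 H; exists (d / 2); first by rewrite divr_gt0.
move=> x y x01; apply: H => //=; last by rewrite divr_gt0.
by rewrite sub0r normrN ger0_norm ?divr_ge0 ?ltW// ltr_pdivrMr// ltr_pMr// ltr1n.
Qed.

Lemma L1_continuous_approx f (e : R) : 0 < e ->
  mu.-integrable `[0, 1] (EFin \o f) -> exists g, [/\ continuous g,
    mu.-integrable `[0, 1] (EFin \o g) &
    \int[mu]_(r in `[0, 1]) `|f r - g r| <= e].
Proof.
move=> e0 fi.
have mu1 : (mu (`[0%R, 1%R]%classic : set R) < +oo)%E by rewrite mu01 ltry.
have [//|g [cg gi]] := @approximation_continuous_integrable R `[0, 1] f _ mu1 fi.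
move=> /fine_cvgP[_] /cvgrPdist_le/(_ e e0)[n _ /(_ n (leqnn n))] /=.
rewrite sub0r normrN => H; exists (g n); split => //.
by apply: le_trans (ler_norm _) _.
Qed.

(** [f] is replaced by a continuous [g] close in L^1, and [g] by its values at the left ends of the
    cells; the integral then becomes a fixed linear combination of cell integrals. A single [k]
    bounds both the mesh and the tolerance, so that any larger [k] works and finitely many of them
    can be merged. *)
Lemma cell_int_modulus f (e : R) : 0 < e -> mu.-integrable `[0, 1] (EFin \o f) ->
  exists k, forall n, (k < n)%N -> forall phi psi, unit_ball phi -> unit_ball psi ->
    (forall i, (i < n)%N ->
       n%:R * `|cell_int n i phi - cell_int n i psi| <= k.+1%:R^-1) ->
    `|\int[mu]_(r in `[0, 1]) (f r * phi r)
      - \int[mu]_(r in `[0, 1]) (f r * psi r)| <= e.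
Proof.
move=> e0 fi.
have e8 : 0 < e / 8 by lra.
have [g [cg gi fg]] := L1_continuous_approx e8 fi.
have [d d0 gd] := continuous01_uniform cg e8.
have [M M0 gM] : exists2 M : R, 0 < M & forall x, `[0, 1]%classic x -> `|g x| <= M.
  have /compact_bounded[M [_ HM]] : compact (g @` `[0, 1]).
    apply: continuous_compact; last exact: segment_compact.
    exact: continuous_subspaceT.
  exists (`|M| + 1) => [|x x01]; first by rewrite ltr_wpDl.
  by apply: HM; [rewrite ltr_pwDr// ler_norm|exists x].
(* The first term makes the cells shorter than the modulus [d], the second makes [M / k.+1] at most
   [e / 4]. *)
pose k := maxn (Num.truncn d^-1) (Num.truncn (M / (e / 4))).
exists k => n kn phi psi B1 B2 H.
have n0 : (0 < n)%N by rewrite (leq_ltn_trans _ kn).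
have n0R : 0 < n%:R :> R by rewrite ltr0n.
have nd : n%:R^-1 < d.
  rewrite invf_plt ?posrE//; apply: lt_le_trans (truncnS_gt _) _.
  by rewrite ler_nat (leq_ltn_trans _ kn)// leq_maxl.
have Mk : M * k.+1%:R^-1 <= e / 4.
  rewrite ler_pdivrMr// mulrC -ler_pdivrMr ?divr_gt0//.
  apply: ltW; apply: lt_le_trans (truncnS_gt _) _.
  by rewrite ler_nat ltnS leq_maxr.
have fgi : mu.-integrable `[0, 1] (EFin \o (fun r => f r - g r)).
  by have := integrableB _ fi gi; exact.
have step p : unit_ball p -> `|\int[mu]_(r in `[0, 1]) (f r * p r)
    - \sum_(i < n) g (i%:R / n%:R) * cell_int n i p| <= e / 4.
  move=> pB.
  have -> : \int[mu]_(r in `[0, 1]) (f r * p r) =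
      \int[mu]_(r in `[0, 1]) ((f r - g r) * p r) +
      \int[mu]_(r in `[0, 1]) (g r * p r).
    rewrite -RintegralD//; [|exact: integrableM_unit_ball..].
    by apply: eq_Rintegral => r _; rewrite -mulrDl subrK.
  rewrite -addrA; apply: le_trans (ler_normD _ _) _.
  have -> : e / 4 = e / 8 + e / 8 by lra.
  apply: lerD; first exact: le_trans (le_RintegralM pB fgi) _.
  have gpi := integrableM_unit_ball pB gi.
  rewrite (cell_intE n0 gpi) -sumrB; apply: le_trans (ler_norm_sum _ _ _) _.
  apply: (@le_trans _ _ (\sum_(i < n) e / 8 / n%:R)); last first.
    by rewrite sumr_const card_ord -[leLHS]mulr_natr divfK// gt_eqF.
  apply: ler_sum => i _.
  have isub := cell_sub (ltn_ord i).
  have mcell : measurable (`[i%:R / n%:R, i.+1%:R / n%:R]%classic : set R) by [].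
  have pci := unit_ball_integrable pB mcell isub.
  have gpc : mu.-integrable `[i%:R / n%:R, i.+1%:R / n%:R]
    (EFin \o (fun r => g r * p r)) by exact: integrableS gpi.
  have cpi : mu.-integrable `[i%:R / n%:R, i.+1%:R / n%:R]
      (EFin \o (fun r => g (i%:R / n%:R) * p r)).
    by apply: (integrableZl _ _ pci).
  rewrite /cell_int -RintegralZl// -RintegralB//.
  have di : mu.-integrable `[i%:R / n%:R, i.+1%:R / n%:R]
      (EFin \o (fun r => g r * p r - g (i%:R / n%:R) * p r)).
    by apply: (integrableB _ gpc cpi).
  apply: le_trans (le_normr_Rintegral _ _) _ => //.
  apply: (@le_trans _ _ (\int[mu]_(r in `[i%:R / n%:R, i.+1%:R / n%:R]) (e / 8))).
    apply: le_Rintegral => //.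
    - exact: (integrable_norm di).
    - by apply: (@bounded_integrable _ _ _ _ _ `|e / 8|) => //; exact: sub_mu01_fin.
    move=> r rc; have r01 := isub _ rc.
    rewrite -mulrBl normrM -[leRHS]mulr1 ler_pM//; last by apply: pB.2.
    apply: ltW; apply: gd => //; apply: le_lt_trans nd.
    move: rc; rewrite /= in_itv/= -natr1 mulrDl mul1r => /andP[r1 r2].
    by rewrite ger0_norm ?subr_ge0// lerBlDl.
  by rewrite Rintegral_cst// [X in fine X](mu_cell i n0).
have A := step _ B1; have B := step _ B2.
rewrite distrC in B.
have C : `|\sum_(i < n) g (i%:R / n%:R) * cell_int n i phi -
           \sum_(i < n) g (i%:R / n%:R) * cell_int n i psi| <= e / 4.
  rewrite -sumrB; apply: le_trans (ler_norm_sum _ _ _) _.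
  apply: (@le_trans _ _ (\sum_(i < n) e / 4 / n%:R)); last first.
    by rewrite sumr_const card_ord -[leLHS]mulr_natr divfK// gt_eqF.
  apply: ler_sum => i _; rewrite -mulrBr normrM.
  rewrite ler_pdivlMr// -mulrA [X in _ * X]mulrC; apply: le_trans Mk.
  rewrite ler_pM//; last exact: H.
  apply: gM; apply: (cell_sub (ltn_ord i)).
  by rewrite /= in_itv/= lexx/= ler_pM2r ?invr_gt0// ler_nat.
set S1 := \sum_(i < n) _ in A C; set S2 := \sum_(i < n) _ in B C.
move: A B C; rewrite !ler_norml => /andP[? ?] /andP[? ?] /andP[? ?].
by apply/andP; split; lra.
Qed.

End integration.

(** * Weak limits and lower semicontinuity *)

Section ultralimit.
Context {R : realType}.
Variables (U : set_system nat) (UU : UltraFilter U).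
Implicit Types u v : nat -> R.

(** The values stay in a compact interval, so they cluster at some [l]. An ultrafilter missing the
    set where |l - u n| < e contains its complement, which contradicts clustering. *)
Lemma bounded_ultra_cvg u (M : R) : (forall n, `|u n| <= M) ->
  cvg (u n @[n --> U]).
Proof.
move=> uM.
have uF : (u n @[n --> U]) `[- M, M]%classic.
  apply: (@filterS _ U _ setT); last exact: filterT.
  by move=> n _; rewrite /= in_itv/=; have := uM n; rewrite ler_norml.
have [l [_ lu]] := segment_compact _ uF.
apply/cvg_ex; exists l; apply/cvgrPdist_lt => e e0.
have [//|nA] := in_ultra_setVsetC [set n | `|l - u n| < e] UU.
have /= := lu (~` [set y | `|l - y| < e]) (ball l e) nA (nbhsx_ballx _ _ e0).
by move=> [y [/=]].
Qed.

Definition ulim u : R := lim (u n @[n --> U]).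

Lemma ulim_cvg u (M : R) : (forall n, `|u n| <= M) -> u n @[n --> U] --> ulim u.
Proof. by move=> /bounded_ultra_cvg. Qed.

End ultralimit.

Section weak_compactness.
Context {R : realType}.
Local Notation RT := (measurableTypeR R).
Implicit Types A B D : set RT.
Notation mu := (@lebesgue_measure R).

Lemma integral_pos_null D (g : R -> R) : measurable D ->
  mu.-integrable D (EFin \o g) -> (forall x, D x -> 0 < g x) ->
  \int[mu]_(x in D) g x <= 0 -> mu D = 0%E.
Proof.
move=> mD gi g0 ig.
have /integrableP[mg _] := gi.
have gfin := integrable_fin_num mD gi.
have : ae_eq mu D (EFin \o g) (cst 0%E).
  apply/(ae_eq_integral_abs mu mD mg).
  have -> : (\int[mu]_(x in D) `|(EFin \o g) x| = \int[mu]_(x in D) (EFin \o g) x)%E.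
    apply: eq_integral => x; rewrite inE => Dx /=.
    by rewrite ger0_norm// ltW// g0.
  apply/eqP; rewrite eq_le integral_ge0 ?andbT//; last first.
    by move=> x Dx; rewrite lee_fin ltW// g0.
  by rewrite -(fineK gfin) lee_fin.
move=> [N [mN N0 DN]]; apply: subset_measure0 N0 => // x Dx.
apply: DN => /= /(_ Dx) [gx0]; have := g0 _ Dx.
by rewrite gx0 ltxx.
Qed.

Section weak_limit.
Variables (U : set_system nat) (UU : UltraFilter U).
Variable phi_ : nat -> R -> R.
Hypothesis phi_ball : forall n, unit_ball (phi_ n).

Let I01 : set RT := `[0, 1]%classic.
Let s A n := \int[mu]_(r in A `&` I01) phi_ n r.
Let m A := fine (mu (A `&` I01)).
Let nu A : \bar R := (ulim U (s A))%:E.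

Let mI A : measurable A -> measurable (A `&` I01).
Proof. by move=> mA; apply: measurableI => //; exact: measurable_itv. Qed.

Let muI A : measurable A -> (mu (A `&` I01) < +oo)%E.
Proof. by move=> mA; apply: sub_mu01_fin; [exact: mI|exact: subIsetr]. Qed.

Let muIE A : measurable A -> mu (A `&` I01) = (m A)%:E.
Proof. by move=> mA; rewrite fineK// ge0_fin_numE// muI. Qed.

Let si A n : measurable A -> mu.-integrable (A `&` I01) (EFin \o phi_ n).
Proof.
by move=> mA; apply: (unit_ball_integrable (phi_ball n) (mI mA)); exact: subIsetr.
Qed.

Let s_le A n : measurable A -> `|s A n| <= m A.
Proof.
move=> mA; apply: le_trans (le_normr_Rintegral _ _) _; [exact: mI|exact: si|].
rewrite /m -[leRHS]mul1r -Rintegral_cst; last exact: mI.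
apply: le_Rintegral; [exact: mI|exact: integrable_norm (si _ mA)| |].
- apply: (@bounded_integrable _ _ _ _ _ _ 1); [exact: mI|exact: muI|by []|].
  by move=> x _; rewrite normr1.
- by move=> x [_ ?]; exact: (phi_ball n).2.
Qed.

Let s_cvg A : measurable A -> s A n @[n --> U] --> ulim U (s A).
Proof. by move=> mA; apply: ulim_cvg (m A) _ => n; exact: s_le. Qed.

Let ulim_le A : measurable A -> `|ulim U (s A)| <= m A.
Proof.
move=> mA; have /cvg_norm sc := s_cvg mA.
apply: (cvgr_to_le sc); apply: nearW => n; exact: s_le.
Qed.

Let ulimU A B : measurable A -> measurable B -> A `&` B = set0 ->
  ulim U (s (A `|` B)) = ulim U (s A) + ulim U (s B).
Proof.
move=> mA mB AB.
have mAB : measurable (A `|` B) by exact: measurableU.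
apply: (cvg_unique _ (s_cvg mAB)) => //.
rewrite (_ : s (A `|` B) = fun n => s A n + s B n); last first.
  apply/funext => n; rewrite /s setIUl Rintegral_setU//; [exact: mI|exact: mI| |].
    by rewrite -setIUl; exact: si.
  by apply/disj_setPS; rewrite setIACA AB set0I.
by apply: cvgD; exact: s_cvg.
Qed.

Let nu0 : nu set0 = 0%E.
Proof.
congr EFin; apply: (@cvg_unique _ _ (s set0 n @[n --> U])) => //.
  exact: s_cvg.
rewrite (_ : s set0 = cst 0); first exact: cvg_cst.
by apply/funext => n; rewrite /s set0I Rintegral_set0.
Qed.

Let nu_fin A : measurable A -> nu A \is a fin_num.
Proof. by []. Qed.

(** A limit along [U] is in general only finitely additive. Here |nu A| is at most the Lebesgue
    measure of [A] within [0,1], so the tails of a countable union are controlled by those of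
    Lebesgue measure. *)
Let nu_semi_sigma_additive : semi_sigma_additive nu.
Proof.
move=> F mF tF mUF.
pose A n := \big[setU/set0]_(i < n) F i.
have mA n : measurable (A n) by apply: bigsetU_measurable.
have AUF n : A n `<=` \bigcup_k F k.
  by rewrite /A -bigcup_mkord; apply: bigcup_sub => i _; exact: bigcup_sup.
have nuA n : (\sum_(0 <= i < n) nu (F i))%E = (ulim U (s (A n)))%:E.
  elim: n => [|n IH]; first by rewrite big_geq// -[LHS]nu0 /nu /A big_ord0.
  rewrite big_nat_recr//= IH /A big_ord_recr/= ulimU//.
    exact: mA.
  apply/seteqP; split=> // x []; rewrite -bigcup_mkord => -[i /= i_n Fix] Fnx.
  have E : i = n by apply: tF => //; exists x.
  by rewrite E ltnn in i_n.
rewrite (_ : (fun n => _) = EFin \o (fun n => ulim U (s (A n)))); last exact/funext.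
apply/fine_cvgP; split; first exact: nearW.
rewrite /=.
have mc : (m \o A) n @[n --> \oo] --> m (\bigcup_k F k).
  have := @nondecreasing_cvg_mu _ _ _ mu (fun n => A n `&` I01).
  rewrite -setI_bigcupl (_ : \bigcup_n A n = \bigcup_k F k); last first.
    apply/seteqP; split => [x [n _ /AUF]//|x [n _ Fx]].
    by exists n.+1 => //; rewrite /A big_ord_recr/=; right.
  move=> /(_ (fun n => mI (mA n)) (mI mUF)) H.
  apply: fine_cvg; rewrite -muIE//; apply: H.
  move=> i j ij; apply/subsetPset; apply: setSI.
  rewrite /A -!bigcup_mkord; apply: bigcup_sub => k /= ki.
  by apply: bigcup_sup => /=; exact: leq_trans ki ij.
apply/cvgrPdist_le => e e0.
move/cvgrPdist_le : mc => /(_ e e0); apply: filterS => n.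
set B := \bigcup_k F k => H; apply: le_trans H.
have mBA : measurable (B `\` A n) by exact: measurableD.
have BE : B = A n `|` (B `\` A n) by rewrite setDUK.
have -> : ulim U (s B) - ulim U (s (A n)) = ulim U (s (B `\` A n)).
  by rewrite {1}BE ulimU// ?setDIK// addrC addKr.
apply: le_trans (ulim_le mBA) _; apply: le_trans (ler_norm _).
rewrite lerBrDl -lee_fin EFinD -!muIE//.
by rewrite -measureU ?setIUl -?setIUl ?setDUK//; [exact: mI|exact: mI|rewrite setIACA setDIK set0I].
Qed.

HB.instance Definition _ := isCharge.Build _ _ _ nu nu0 nu_fin nu_semi_sigma_additive.

Let nu_dom : nu `<< mu.
Proof.
apply/null_content_dominatesP => A mA A0; congr EFin.
apply/eqP; rewrite -normr_le0; apply: le_trans (ulim_le mA) _.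
rewrite /m (_ : mu _ = 0%E)//; apply: subset_measure0 A0 => //.
exact: mI.
Qed.

Let f r := fine (Radon_Nikodym nu mu r).

Let fE : EFin \o f = Radon_Nikodym nu mu.
Proof. apply/funext => r /=; rewrite fineK//; apply: Radon_Nikodym_fin_num; exact: nu_dom. Qed.

Let fi A : measurable A -> mu.-integrable A (EFin \o f).
Proof.
move=> mA; rewrite fE; apply: integrableS (Radon_Nikodym_integrable nu_dom) => //.
Qed.

Let f_int A : measurable A -> \int[mu]_(r in A) f r = ulim U (s A).
Proof.
move=> mA; have := Radon_Nikodym_integral nu_dom mA.
by rewrite /Rintegral -fE => <-.
Qed.

Let mf : measurable_fun setT f.
Proof. by have /integrableP[/measurable_EFinP] := fi measurableT. Qed.

Let mbad c : measurable ([set r : RT | c * f r > 1] `&` I01).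
Proof.
apply: measurableI; last exact: measurable_itv.
rewrite -[X in measurable X]setTI.
rewrite (_ : [set r : RT | _] = (fun r => c * f r) @^-1` `]1, +oo[); last first.
  by apply/seteqP; split=> r /=; rewrite in_itv/= andbT.
have mcf : measurable_fun setT (fun r : RT => c * f r) by apply: measurable_funM.
by apply: mcf => //; exact: measurable_itv.
Qed.

(** The integral of [c * f - 1], positive on this set, is [c] times a limit bounded by the measure
    of the set, minus that measure, hence nonpositive. The cases [c = 1] and [c = -1] give |f| <= 1
    almost everywhere on [0,1]. *)
Let bad0 c : `|c| = 1 -> mu ([set r | c * f r > 1] `&` I01) = 0%E.
Proof.
move=> c1; have mb := mbad c.
set D := _ `&` _ in mb *.
have DI : D `&` I01 = D by rewrite /D -setIA setIid.
have cfi : mu.-integrable D (EFin \o (fun r => c * f r)).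
  exact: (integrableZl mb c (fi mb)).
have oi : mu.-integrable D (EFin \o cst 1).
  apply: (@bounded_integrable _ _ _ _ _ _ 1) => //; last by move=> ? _; rewrite normr1.
  by rewrite -DI; exact: muI.
apply: (@integral_pos_null _ (fun r => c * f r - 1)) => //.
- exact: (integrableB mb cfi oi).
- by move=> x [/= + _]; rewrite subr_gt0.
- rewrite RintegralB// RintegralZl// ?f_int//; last exact: fi.
  rewrite Rintegral_cst// mul1r subr_le0.
  apply: le_trans (ler_norm _) _; rewrite normrM c1 mul1r.
  by apply: le_trans (ulim_le mb) _; rewrite /m DI.
Qed.

(* The limits along [U] of the integrals over [A] form a signed measure
   dominated by [mu]; its Radon-Nikodym derivative is the weak limit. *)
Lemma weak_limit : exists2 phi, unit_ball phi &
  forall A, measurable A -> A `<=` `[0, 1] ->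
    \int[mu]_(r in A) phi_ n r @[n --> U] --> \int[mu]_(r in A) phi r.
Proof.
(* [unit_ball] asks for the bound at every point of [0,1]; truncation secures it and changes [f]
   only on a null subset of [0,1]. *)
pose phi r := Num.max (-1) (Num.min 1 (f r)).
have mphi : measurable_fun setT phi.
  by apply: measurable_maxr => //; exact: measurable_minr.
have phi1 r : `|phi r| <= 1.
  rewrite ler_norml /phi le_max lexx/= ge_max ge_min lexx/= andbT; lra.
exists phi; first by split => //; exact: measurable_funTS.
move=> A mA A01.
have AI : A `&` I01 = A by apply/setIidl.
have -> : \int[mu]_(r in A) phi r = ulim U (s A).
  rewrite -f_int// /Rintegral; congr fine.
  apply: ae_eq_integral => //.
  - by apply/measurable_EFinP; exact: measurable_funTS.
  - by apply/measurable_EFinP; exact: measurable_funTS.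
  exists (([set r | 1 * f r > 1] `&` I01) `|` ([set r | -1 * f r > 1] `&` I01)).
  split.
  - by apply: measurableU; exact: mbad.
  - apply/eqP; rewrite eq_le measure_ge0 andbT.
    apply: le_trans (measureU2 _ (mbad _) (mbad _)) _.
    rewrite -[leRHS]adde0; apply: leeD; rewrite le_eqVlt; apply/orP; left;
      by apply/eqP; apply: bad0; rewrite ?normrN normr1.
  - move=> r /= /not_implyP[Ar pf].
    have [f1|f1] := ltP 1 (f r); first by left; split; [rewrite mul1r|exact: A01].
    have [f2|f2] := ltP (f r) (-1).
      by right; split; [rewrite mulN1r ltrNr|exact: A01].
    exfalso; apply: pf; congr EFin; rewrite /phi.
    by rewrite min_r// max_r.
have := s_cvg mA; rewrite (_ : s A = fun n => \int[mu]_(r in A) phi_ n r)//.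
by apply/funext => n; rewrite /s AI.
Qed.

End weak_limit.

Definition rate_int (phi : R -> R) : R := \int[mu]_(r in `[0, 1]) Lst (phi r).

Lemma measurable_Lst D (phi : R -> R) : measurable_fun D phi ->
  measurable_fun D (fun r => Lst (phi r)).
Proof.
move=> mphi; apply: measurable_funB => //.
apply: (@measurableT_comp _ _ _ _ _ _ (@Num.sqrt R)).
  exact: continuous_measurable_fun (@sqrt_continuous R).
by apply: measurable_funB => //; exact: measurable_funX.
Qed.

Lemma Lst_integrable D (phi : R -> R) : measurable D -> (mu D < +oo)%E ->
  measurable_fun D phi -> mu.-integrable D (EFin \o (fun r => Lst (phi r))).
Proof.
move=> mD D1 mphi; apply: (@bounded_integrable _ _ _ _ _ _ 1) => //.
  exact: measurable_Lst.
by move=> r _; rewrite ger0_norm ?Lst_ge0// Lst_le1.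
Qed.

Lemma Rintegral_affine D (f : R -> R) (a c : R) : measurable D -> (mu D < +oo)%E ->
  mu.-integrable D (EFin \o f) -> mu.-integrable D (EFin \o (fun r => a * f r - c)) /\
  \int[mu]_(r in D) (a * f r - c) = a * \int[mu]_(r in D) f r - c * fine (mu D).
Proof.
move=> mD D1 fi.
have ci : mu.-integrable D (EFin \o cst c).
  by apply: (@bounded_integrable _ _ _ _ _ _ `|c|).
have afi : mu.-integrable D (EFin \o (fun r => a * f r)) := integrableZl mD a fi.
split; first exact: (integrableB mD afi ci).
by rewrite RintegralB// RintegralZl// Rintegral_cst.
Qed.

Section rate_lsc.
Variables (U : set_system nat) (UU : UltraFilter U).
Variables (phi_ : nat -> R -> R) (phi : R -> R).
Hypothesis phi_ball : forall n, unit_ball (phi_ n).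
Hypothesis ballphi : unit_ball phi.
Hypothesis phi_cvg : forall A, measurable A -> A `<=` `[0, 1] ->
  \int[mu]_(r in A) phi_ n r @[n --> U] --> \int[mu]_(r in A) phi r.

(* [D] is cut into the regions where a given tilt of the grid is almost optimal
   for [phi]; on each of them [Lst] is bounded below by an affine function, whose
   integral passes to the limit. *)
Let rate_lsc_grid (h : R) (q : seq R) : forall (e : R) D, 0 < e -> measurable D ->
  D `<=` `[0, 1] ->
  (forall r, D r -> exists2 l, l \in q & Lst (phi r) - h <= l * phi r - Lam l) ->
  \forall n \near U, \int[mu]_(r in D) Lst (phi r) - h * fine (mu D) - e <=
    \int[mu]_(r in D) Lst (phi_ n r).
Proof.
elim: q => [|l q IH] e D e0 mD D01 Dq.
  have -> : D = set0 by apply/seteqP; split=> // r /Dq[].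
  apply: nearW => n; rewrite !Rintegral_set0 measure0 mulr0; lra.
have D1 : (mu D < +oo)%E by exact: sub_mu01_fin.
have mphi : measurable_fun D phi by exact: measurable_funS ballphi.1.
pose g r := l * phi r - Lam l - Lst (phi r) + h.
have mg : measurable_fun D g.
  apply: measurable_funD => //; apply: measurable_funB; last exact: measurable_Lst.
  by apply: measurable_funB => //; exact: measurable_funM.
pose E := D `&` g @^-1` `[0, +oo[.
have mE : measurable E by apply: mg => //; exact: measurable_itv.
have mF : measurable (D `\` E) by exact: measurableD.
have ED : E `<=` D by exact: subIsetl.
have FD : D `\` E `<=` D by exact: subDsetl.
have DE : D = E `|` (D `\` E) by rewrite setDUK.
have dEF : [disjoint E & D `\` E] by apply/disj_setPS; rewrite setDIK.
have E01 := subset_trans ED D01; have F01 := subset_trans FD D01.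
have E1 := sub_mu01_fin mE E01; have F1 := sub_mu01_fin mF F01.
have muD : fine (mu D) = fine (mu E) + fine (mu (D `\` E)).
  rewrite -fineD ?ge0_fin_numE//; congr fine; rewrite {1}DE measureU//.
  exact: setDIK.
have splitD f : mu.-integrable D (EFin \o f) ->
    \int[mu]_(r in D) f r = \int[mu]_(r in E) f r + \int[mu]_(r in D `\` E) f r.
  by move=> fi; rewrite {1}DE Rintegral_setU// -DE.
have mphin n : measurable_fun D (phi_ n) by exact: measurable_funS (phi_ball n).1.
have e2 : 0 < e / 2 by lra.
have cvE : l * \int[mu]_(r in E) phi_ n r @[n --> U] --> l * \int[mu]_(r in E) phi r.
  by apply: cvgM; [exact: cvg_cst|exact: phi_cvg].
move/cvgrPdist_le : cvE => /(_ _ e2) nearE.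
have nearF := IH (e / 2) _ e2 mF F01.
have {}nearF := nearF _; apply: filterS2 nearE (nearF _).
  move=> n nE nF.
  rewrite !splitD; [|exact: Lst_integrable..].
  have Lphi : mu.-integrable E (EFin \o (fun r => Lst (phi r))).
    by apply: Lst_integrable => //; exact: measurable_funS mphi.
  have Lphin : mu.-integrable E (EFin \o (fun r => Lst (phi_ n r))).
    by apply: Lst_integrable => //; exact: measurable_funS (mphin n).
  have phiE := unit_ball_integrable ballphi mE E01.
  have phinE := unit_ball_integrable (phi_ball n) mE E01.
  have [i1 H1] := Rintegral_affine l (Lam l) mE E1 phiE.
  have [i2 H2] := Rintegral_affine l (Lam l) mE E1 phinE.
  have [i3 H3] := Rintegral_affine 1 h mE E1 Lphi.
  have A1 : \int[mu]_(r in E) (1 * Lst (phi r) - h) <=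
      \int[mu]_(r in E) (l * phi r - Lam l).
    apply: le_Rintegral => // r [_ /=]; rewrite in_itv/= andbT /g mul1r; lra.
  have A2 : \int[mu]_(r in E) (l * phi_ n r - Lam l) <=
      \int[mu]_(r in E) Lst (phi_ n r).
    by apply: le_Rintegral => // r Er; apply: Lam_young; apply: (phi_ball n).2; exact: E01.
  rewrite mul1r in H3.
  move: A1 A2 nE nF; rewrite H1 H2 H3 muD mulrDr ler_norml.
  move: (\int[mu]_(r in E) Lst (phi r)) (\int[mu]_(r in D `\` E) Lst (phi r))
    (\int[mu]_(r in E) Lst (phi_ n r)) (\int[mu]_(r in D `\` E) Lst (phi_ n r))
    (l * \int[mu]_(r in E) phi r) (l * \int[mu]_(r in E) phi_ n r)
    (Lam l * fine (mu E)) (h * fine (mu E)) (h * fine (mu (D `\` E))).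
  by clear; move=> x1 x2 x3 x4 x5 x6 x7 x8 x9 A1 A2 /andP[A3 A4] A5; lra.
move=> r [Dr nEr]; have [l'] := Dq r Dr; rewrite inE => /orP[/eqP ->|l'q] H.
  by exfalso; apply: nEr; split => //=; rewrite in_itv/= andbT /g; lra.
by exists l'.
Qed.

Lemma rate_int_lsc (c : R) : (forall n, rate_int (phi_ n) <= c) -> rate_int phi <= c.
Proof.
move=> Jc; apply/ler_addgt0Pr => e e0.
have e2 : 0 < e / 2 by lra.
have [q Hq] := @Lam_grid R _ e2.
have [||n Hn] := @filter_ex _ U _ _
    (@rate_lsc_grid (e / 2) q (e / 2) `[0, 1]%classic e2 (measurable_itv _) _ _).
- by [].
- by move=> r r01; apply: Hq; exact: ballphi.2.
have mu1 : fine (mu `[0, 1]%classic) = 1 by rewrite mu01.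
by have := Jc n; move: Hn; rewrite /rate_int mu1; lra.
Qed.

End rate_lsc.
End weak_compactness.

(** * Moment generating function of the telegraph signal *)

Section two_state_chain.
Context {R : realType}.
Implicit Types (l h q x : R) (cs ls : seq R).

(** [expR x = 1 / expR (- x) <= 1 / (1 - x)], and [(1 + x + 2 x^2) (1 - x) = 1 + x^2 (1 - 2 x) >=
    1]. *)
Lemma expR_le_quad x : `|x| <= 1 / 2 -> expR x <= 1 + x + 2 * x ^+ 2.
Proof.
rewrite ler_norml => /andP[x1 x2].
have A := expR_ge1Dx (- x).
have B : 0 < 1 - x by lra.
have -> : expR x = (expR (- x))^-1 by rewrite expRN invrK.
apply: (@le_trans _ _ (1 - x)^-1); first by rewrite lef_pV2// posrE// expR_gt0.
rewrite -div1r ler_pdivrMr//.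
have := sqr_ge0 x; nra.
Qed.

Definition sqrtD1 l : R := Num.sqrt (1 + l ^+ 2).
(* On [{-1, 1}], the eigenvector for the eigenvalue [Lam l] of the generator
   [v |-> v (- x) - v x] tilted by [l * x]. *)
Definition eigvec l x : R := sqrtD1 l + 1 + l * x.
Definition eigvec_max l : R := sqrtD1 l + 1 + `|l|.

Lemma sqrtD1_norm l : `|l| <= sqrtD1 l.
Proof. by rewrite -sqrtr_sqr ler_wsqrtr// lerDr. Qed.

Lemma sqr_sqrtD1 l : sqrtD1 l ^+ 2 = 1 + l ^+ 2.
Proof. by rewrite sqr_sqrtr// addr_ge0// sqr_ge0. Qed.

Lemma eigvec_bound l x : `|x| = 1 -> 1 <= eigvec l x <= eigvec_max l.
Proof.
move=> x1; have := sqrtD1_norm l; have : `|l * x| = `|l| by rewrite normrM x1 mulr1.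
rewrite /eigvec /eigvec_max; have := ler_norm (l * x); have := ler_norm (- (l * x)).
by rewrite normrN; move: (l * x) => y; lra.
Qed.

(** To first order in [h], a step of the tilted chain acts on the eigenvector through the eigenvalue
    equation [eig]; everything else is of order [h^2], including the uncertainty on the flip
    probability [q]. [C] depends on [l] alone, so that the errors can be summed over many steps. *)
Lemma chain_step l : exists2 C, 1 <= C & forall h q x, 0 < h -> 4 * C * h <= 1 ->
  h - h ^+ 2 <= q <= h -> `|x| = 1 ->
  expR (h * Lam l - C * h ^+ 2) * eigvec l x
    <= (1 - q) * (expR (h * l * x) * eigvec l x)
       + q * (expR (- (h * l * x)) * eigvec l (- x))
    <= expR (h * Lam l + C * h ^+ 2) * eigvec l x.
Proof.
set S := eigvec_max l.
(* In units of [h^2], the three terms bound the Taylor remainder of the exponential, the error of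
   replacing [q] by [h], and the interaction of the flip with the weight. In the witness,
   [4 * Lam l ^+ 2] pays for the quadratic term of the exponential in the lower bound, while [Lam l]
   and |l| ensure that [4 * C * h <= 1] keeps all exponents small. *)
pose E := 2 * l ^+ 2 * S + 2 * `|l| + 4 * S * `|l|.
exists (E + 4 * Lam l ^+ 2 + Lam l + `|l| + 1).
  have S0 : 0 <= S by rewrite /S /eigvec_max addr_ge0// addr_ge0// sqrtr_ge0.
  have := Lam_ge0 l; have := sqr_ge0 (Lam l); have := normr_ge0 l; have := sqr_ge0 l.
  by rewrite /E; nra.
move=> h q x h0; set C := _ + 1 => hC /andP[q1 q2] x1.
have x2 : x ^+ 2 = 1 by rewrite -[x ^+ 2]real_normK ?num_real// x1 expr1n.
have /andP[a1 aS] := eigvec_bound l x1.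
have /andP[b1 bS] : 1 <= eigvec l (- x) <= eigvec_max l.
  by apply: eigvec_bound; rewrite normrN.
have ab : eigvec l (- x) - eigvec l x = - 2 * (l * x) by rewrite /eigvec; ring.
have eig : (l * x - 1) * eigvec l x + eigvec l (- x) = Lam l * eigvec l x.
  rewrite /Lam -/(sqrtD1 l) /eigvec.
  have := sqr_sqrtD1 l; set s := sqrtD1 l => s2.
  have -> : (l * x - 1) * (s + 1 + l * x) + (s + 1 + l * - x) =
    l * x * s + l ^+ 2 * x ^+ 2 - l * x by ring.
  have -> : (s - 1) * (s + 1 + l * x) = s ^+ 2 - 1 + l * x * s - l * x by ring.
  by rewrite x2 s2; ring.
have ml : `|l * x| = `|l| by rewrite normrM x1 mulr1.
have l2 : l ^+ 2 = (l * x) ^+ 2 by rewrite exprMn x2 mulr1.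
rewrite -!mulrA; rewrite /C /E l2 -ml in hC *.
rewrite -/S in aS bS.
move: (Lam_ge0 l) a1 aS b1 bS ab eig hC; clear ml l2 C E.
move: (Lam l) (eigvec l x) (eigvec l (- x)) (l * x) S; clear x x1 x2 l.
move=> L a b m S L0 a1 aS b1 bS ab eig.
set E := 2 * m ^+ 2 * S + 2 * `|m| + 4 * S * `|m|.
set C := E + 4 * L ^+ 2 + L + `|m| + 1 => hC.
have E0 : 0 <= E by rewrite /E; have := normr_ge0 m; have := sqr_ge0 m; nra.
have C1 : 1 <= C by rewrite /C; have := normr_ge0 m; have := sqr_ge0 L; nra.
have CL : L <= C by rewrite /C; have := normr_ge0 m; have := sqr_ge0 L; nra.
have Cm : `|m| <= C by rewrite /C; have := normr_ge0 m; have := sqr_ge0 L; nra.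
have h1 : h <= 1 / 4 by nra.
have hm : `|h * m| <= 1 / 2 by rewrite normrM gtr0_norm//; nra.
have hmN : `|- (h * m)| <= 1 / 2 by rewrite normrN.
have P1 := expR_le_quad hm; have P2 := expR_le_quad hmN.
have P3 := expR_ge1Dx (h * m); have P4 := expR_ge1Dx (- (h * m)).
have p0 := expR_ge0 (h * m); have n0 := expR_ge0 (- (h * m)).
rewrite sqrrN in P2.
set y := h * m in hm hmN P1 P2 P3 P4 p0 n0 *.
set ep := expR y in P1 P3 p0 *; set en := expR (- y) in P2 P4 n0 *.
have yy : y ^+ 2 <= `|y| / 2.
  by rewrite -[y ^+ 2]real_normK ?num_real//; have := normr_ge0 y; nra.
have [ny1 ny2] := (ler_norm y, ler_norm (- y)); rewrite normrN in ny2.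
have Dp : `|ep - 1| <= 2 * `|y| by rewrite ler_norml; lra.
have Dn : `|en - 1| <= 2 * `|y| by rewrite ler_norml; lra.
have ny : `|y| = h * `|m| by rewrite normrM gtr0_norm.
have q0 : 0 <= q by nra.
set f := (1 - q) * (ep * a) + q * (en * b).
have fE : f = a * (1 + h * L) + (a * (ep - 1 - y)
    + (q - h) * (b - a) + q * (b * (en - 1) - a * (ep - 1))).
  have -> : a * (1 + h * L) = a + h * (L * a) by ring.
  by rewrite -eig /f /y; ring.
set err := a * (ep - 1 - y) + _ + _ in fE.
have A1 : `|a * (ep - 1 - y)| <= h ^+ 2 * (2 * m ^+ 2 * S).
  have -> : h ^+ 2 * (2 * m ^+ 2 * S) = S * (2 * y ^+ 2) by rewrite /y; ring.
  rewrite normrM ler_pM//; first by rewrite ger0_norm//; lra.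
  by rewrite ger0_norm; lra.
have A2 : `|(q - h) * (b - a)| <= h ^+ 2 * (2 * `|m|).
  rewrite normrM ler_pM//; last by rewrite ab mulNr normrN normrM ger0_norm.
  by rewrite ler_norml; lra.
have A3 : `|q * (b * (en - 1) - a * (ep - 1))| <= h ^+ 2 * (4 * S * `|m|).
  have -> : h ^+ 2 * (4 * S * `|m|) = h * (S * (2 * `|y|) + S * (2 * `|y|)).
    by rewrite ny; ring.
  rewrite normrM ler_pM//; first by rewrite ger0_norm.
  apply: le_trans (ler_normB _ _) _.
  apply: lerD; rewrite normrM; apply: ler_pM => //.
    by rewrite ger0_norm// (le_trans ler01).
  by rewrite ger0_norm// (le_trans ler01).
have Aerr : `|err| <= h ^+ 2 * E.
  rewrite /err /E [leRHS]mulrDr [X in _ <= X + _]mulrDr.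
  apply: le_trans (ler_normD _ _) _; apply: lerD A3.
  by apply: le_trans (ler_normD _ _) _; exact: lerD.
move: Aerr; rewrite ler_norml => /andP[e1 e2].
have h2 : 0 <= h ^+ 2 by exact: sqr_ge0.
have EC : E <= C by rewrite /C; have := normr_ge0 m; have := sqr_ge0 L; lra.
have CE : E + 4 * L ^+ 2 + 1 <= C by rewrite /C; have := normr_ge0 m; lra.
clearbody err C E f; clear - h0 hC L0 a1 E0 C1 CL h1 e1 e2 h2 EC CE fE.
(* As [1 <= a], the additive error [h ^+ 2 * E] is also a relative one. *)
have a0 : 0 <= (a - 1) * (h ^+ 2 * E) by rewrite mulr_ge0 ?subr_ge0// mulr_ge0.
rewrite fE; apply/andP; split.
- have Y : `|h * L - C * h ^+ 2| <= 1 / 2.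
    have : 0 <= h * L by rewrite mulr_ge0// ltW.
    have : 0 <= C * h ^+ 2 by rewrite mulr_ge0// (le_trans ler01).
    have : h * L <= 1 / 4 by nra.
    have : C * h ^+ 2 <= 1 / 4 by nra.
    by rewrite ler_norml; lra.
  have G := expR_le_quad Y.
  have Ch2 : (C * h) ^+ 2 <= 1 / 16.
    have : 0 <= C * h by nra.
    have : C * h <= 1 / 4 by lra.
    by move: (C * h) => z; nra.
  have G2 : 1 + (h * L - C * h ^+ 2) + 2 * (h * L - C * h ^+ 2) ^+ 2 <=
      1 + h * L - h ^+ 2 * E.
    have : 2 * (h * L - C * h ^+ 2) ^+ 2 <= 4 * (h * L) ^+ 2 + 4 * (C * h ^+ 2) ^+ 2.
      by have := sqr_ge0 (h * L + C * h ^+ 2); lra.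
    have -> : (h * L) ^+ 2 = h ^+ 2 * L ^+ 2 by ring.
    have -> : (C * h ^+ 2) ^+ 2 = h ^+ 2 * (C * h) ^+ 2 by ring.
    have : h ^+ 2 * (C * h) ^+ 2 <= h ^+ 2 * (1 / 16) by rewrite ler_wpM2l.
    have : h ^+ 2 * (E + 4 * L ^+ 2 + 1) <= h ^+ 2 * C by rewrite ler_wpM2l.
    by move: (h ^+ 2 * (C * h) ^+ 2) => z; lra.
  by have := ler_wpM2r (le_trans ler01 a1) (le_trans G G2); lra.
- have G := expR_ge1Dx (h * L + C * h ^+ 2).
  have := ler_wpM2r (le_trans ler01 a1) G.
  have : 0 <= a * (h ^+ 2 * (C - E)).
    by apply: mulr_ge0; [exact: le_trans ler01 a1|rewrite mulr_ge0 ?subr_ge0].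
  by lra.
Qed.

(* Moment generating function, with weights [cs], of the chain on [{-1, 1}]
   started at [x] and flipping with probability [q]; each weight applies to the
   position after the corresponding step. *)
Fixpoint chain_mgf q cs x : R :=
  if cs is c :: cs' then
    (1 - q) * (expR (c * x) * chain_mgf q cs' x)
    + q * (expR (- (c * x)) * chain_mgf q cs' (- x))
  else 1.

(** Induction on the blocks. Inside a block the eigenvector of its tilt carries the estimate from
    step to step. At a block boundary the eigenvectors do not match, and bounding one between [1]
    and [eigvec_max l] costs a constant factor. There is one such factor per block, whatever [m] and
    [h], so [V] depends on [ls] only. *)
Lemma chain_mgf_bound ls : exists C V, [/\ 1 <= C, 1 <= V &
  forall h q m x, 0 < h -> 4 * C * h <= 1 -> h - h ^+ 2 <= q <= h -> `|x| = 1 ->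
  V^-1 * expR (m%:R * h * \sum_(l <- ls) Lam l - m%:R * C * h ^+ 2)
    <= chain_mgf q (flatten [seq nseq m (h * l) | l <- ls]) x
    <= V * expR (m%:R * h * \sum_(l <- ls) Lam l + m%:R * C * h ^+ 2)].
Proof.
elim: ls => [|l ls [C [V [C1 V1 IH]]]].
  exists 1, 1; split => // h q m x h0 _ _ _ /=.
  rewrite big_nil mulr0 !add0r invr1 !mul1r mulr1.
  by rewrite expRN invf_le1 ?expR_gt0// -expR0 ler_expR mulr_ge0 ?sqr_ge0.
have [D D1 step] := chain_step l.
have [W1 W2] : 1 <= eigvec_max l /\ 0 < eigvec_max l.
  have /andP[A B] := @eigvec_bound l 1 (normr1 _).
  by split; [exact: le_trans B|apply: lt_le_trans (le_trans A B)].
exists (C + D), (V * eigvec_max l); split; [lra|by rewrite -[leLHS]mulr1 ler_pM|].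
move=> h q m x h0 hCD hq x1.
have q0 : 0 <= q by nra.
have q1 : 0 <= 1 - q by nra.
set cs := flatten [seq nseq m (h * l0) | l0 <- ls].
set b := V^-1 * expR (m%:R * h * \sum_(l <- ls) Lam l - m%:R * C * h ^+ 2).
set B := V * expR (m%:R * h * \sum_(l <- ls) Lam l + m%:R * C * h ^+ 2).
have bB y : `|y| = 1 -> b <= chain_mgf q cs y <= B by move=> ?; apply: IH => //; nra.
have b0 : 0 <= b by rewrite mulr_ge0 ?expR_ge0// invr_ge0; lra.
have B0 : 0 <= B by rewrite mulr_ge0 ?expR_ge0//; lra.
(* Steps within the block of [l]: [b] and [B] bound what the remaining blocks contribute, from
   either starting point. *)
have H k y : `|y| = 1 ->
    b / eigvec_max l * expR (k%:R * (h * Lam l - D * h ^+ 2)) * eigvec l y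
    <= chain_mgf q (nseq k (h * l) ++ cs) y
    <= B * expR (k%:R * (h * Lam l + D * h ^+ 2)) * eigvec l y.
  elim: k y => [|k IHk] y y1.
    rewrite !mul0r expR0 !mulr1 /=.
    have /andP[v1 v2] := eigvec_bound l y1.
    have /andP[c1 c2] := bB _ y1; apply/andP; split.
      by apply: le_trans c1; rewrite -mulrA ler_piMr// mulrC ler_pdivrMr// mul1r.
    by apply: le_trans c2 _; rewrite ler_peMr.
  have yN : `|- y| = 1 by rewrite normrN.
  have /andP[s1 s2] : _ <= _ <= _ := step h q y h0 ltac:(nra) hq y1.
  have /andP[c1 c2] := IHk _ y1; have /andP[d1 d2] := IHk _ yN.
  have EE z : expR (k.+1%:R * z) = expR (k%:R * z) * expR z.
    by rewrite -natr1 mulrDl mul1r expRD.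
  rewrite /= !EE; apply/andP; split.
    set e := expR (h * Lam l - D * h ^+ 2) in s1 *.
    set c := b / _ * _ in c1 d1.
    have c0 : 0 <= c by rewrite mulr_ge0 ?divr_ge0 ?expR_ge0// ltW.
    have -> : b / eigvec_max l * (expR (k%:R * (h * Lam l - D * h ^+ 2)) * e)
        * eigvec l y = c * (e * eigvec l y) by rewrite /c; ring.
    apply: le_trans (ler_wpM2l c0 s1) _.
    rewrite mulrDr !(mulrCA c); apply: lerD; rewrite ler_wpM2l// ler_wpM2l ?expR_ge0//.
  set e := expR (h * Lam l + D * h ^+ 2) in s2 *.
  set c := B * _ in c2 d2.
  have c0 : 0 <= c by rewrite mulr_ge0 ?expR_ge0.
  have -> : B * (expR (k%:R * (h * Lam l + D * h ^+ 2)) * e)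
        * eigvec l y = c * (e * eigvec l y) by rewrite /c; ring.
  apply: le_trans (ler_wpM2l c0 s2).
  by rewrite mulrDr !(mulrCA c); apply: lerD; rewrite ler_wpM2l// ler_wpM2l ?expR_ge0.
have /andP[v1 v2] := eigvec_bound l x1.
have /andP[c1 c2] := H m _ x1; rewrite /= -/cs big_cons; apply/andP; split.
  apply: le_trans c1.
  rewrite (_ : m%:R * h * _ - _ = (m%:R * h * \sum_(j <- ls) Lam j - m%:R * C * h ^+ 2)
     + m%:R * (h * Lam l - D * h ^+ 2)); last by ring.
  rewrite expRD invfM -[leLHS]mulr1 /b.
  set e1 := expR _; set e2 := expR _.
  rewrite (_ : V^-1 / eigvec_max l * (e1 * e2) = V^-1 * e1 / eigvec_max l * e2); last by ring.
  rewrite ler_wpM2l// !mulr_ge0 ?expR_ge0// invr_ge0; lra.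
apply: le_trans c2 _.
rewrite (_ : m%:R * h * _ + _ = (m%:R * h * \sum_(j <- ls) Lam j + m%:R * C * h ^+ 2)
     + m%:R * (h * Lam l + D * h ^+ 2)); last by ring.
rewrite expRD /B.
set e1 := expR _; set e2 := expR _.
rewrite (_ : V * eigvec_max l * (e1 * e2) = V * e1 * e2 * eigvec_max l); last by ring.
rewrite ler_wpM2l// !mulr_ge0 ?expR_ge0//; lra.
Qed.

End two_state_chain.

(** * Expansion of the chain over its sign paths *)

Section path_expansion.
Context {R : realType}.
Implicit Types (X : nat -> R) (cs ls : seq R) (bs : seq bool) (q x : R).

(** A weight meets the position after its step, as in [chain_mgf]; in the application this yields
    Riemann sums at right endpoints. *)
Fixpoint path_sum X cs j : R :=
  if cs is c :: cs' then c * X j.+1 + path_sum X cs' j.+1 else 0.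

Lemma path_sum_cat X cs cs' j :
  path_sum X (cs ++ cs') j = path_sum X cs j + path_sum X cs' (j + size cs).
Proof.
elim: cs j => [|c cs IH] j /=; first by rewrite add0r addn0.
by rewrite IH addrA addSnnS.
Qed.

Lemma path_sum_nseq X m c j :
  path_sum X (nseq m c) j = c * \sum_(k < m) X (j + k.+1)%N.
Proof.
elim: m j => [|m IH] j /=; first by rewrite big_ord0 mulr0.
rewrite IH big_ord_recl mulrDr addn1; congr (_ + c * _).
by apply: eq_bigr => i _; rewrite addSnnS.
Qed.

Lemma path_sum_blocks X m h ls j :
  path_sum X (flatten [seq nseq m (h * l) | l <- ls]) j =
  \sum_(i < size ls) h * ls`_i * \sum_(k < m) X (j + i * m + k.+1)%N.
Proof.
elim: ls j => [|l ls IH] j /=; first by rewrite big_ord0.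
rewrite path_sum_cat path_sum_nseq size_nseq IH big_ord_recl /=.
congr (_ * _ + _); first by apply: eq_bigr => k _; rewrite mul0n addn0.
apply: eq_bigr => i _; congr (_ * _); apply: eq_bigr => k _.
by rewrite /bump/= add1n mulSn addnA.
Qed.

(** [bs] tells which steps flip the sign. The path is thus expressed through the parities of the
    increments, which are independent, instead of the positions, which are not. *)
Fixpoint sign_sum cs bs x : R :=
  match cs, bs with
  | c :: cs', b :: bs' =>
      c * ((-1) ^+ (b : bool) * x) + sign_sum cs' bs' ((-1) ^+ (b : bool) * x)
  | _, _ => 0
  end.

Lemma path_sumE X (b : nat -> bool) cs j :
  (forall k, X k.+1 = (-1) ^+ b k * X k) ->
  path_sum X cs j = sign_sum cs [seq b k | k <- iota j (size cs)] (X j).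
Proof. by move=> Xb; elim: cs j => [//|c cs IH] j /=; rewrite IH -Xb. Qed.

Fixpoint bool_seqs n : seq (seq bool) :=
  if n is n'.+1 then map (cons true) (bool_seqs n') ++ map (cons false) (bool_seqs n')
  else [:: [::]].

Lemma mem_bool_seqs n bs : (bs \in bool_seqs n) = (size bs == n).
Proof.
elim: n bs => [|n IH] [|b bs] //=.
  by rewrite mem_cat; apply/negbTE; rewrite negb_or; apply/andP; split; apply/mapP => -[].
rewrite eqSS -IH mem_cat; case: b.
  rewrite (mem_map (f := cons true)); last by move=> ? ? [].
  by rewrite (_ : _ \in map _ _ = false) ?orbF//; apply/negbTE/negP => /mapP[].
rewrite orbC (mem_map (f := cons false)); last by move=> ? ? [].
by rewrite (_ : _ \in map _ _ = false) ?orbF//; apply/negbTE/negP => /mapP[].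
Qed.

Lemma uniq_bool_seqs n : uniq (bool_seqs n).
Proof.
elim: n => [//|n IH] /=; rewrite cat_uniq !map_inj_uniq ?IH//=; try by move=> ? ? [].
by rewrite andbT; apply/hasPn => bs /mapP[bs' _ ->]; apply/mapP => -[].
Qed.

Definition parity_weight q bs : R := \prod_(b <- bs) (if b then q else 1 - q).

Lemma chain_mgf_paths q cs x : chain_mgf q cs x =
  \sum_(bs <- bool_seqs (size cs)) parity_weight q bs * expR (sign_sum cs bs x).
Proof.
elim: cs x => [|c cs IH] x /=.
  by rewrite big_seq1 /parity_weight big_nil expR0 mulr1.
rewrite big_cat !big_map/= addrC !IH; congr (_ + _).
- rewrite expr0 mul1r !mulr_sumr; apply: eq_bigr => bs _.
  by rewrite /parity_weight big_cons expRD; ring.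
- rewrite expr1 mulN1r !mulr_sumr; apply: eq_bigr => bs _.
  by rewrite /parity_weight big_cons expRD mulrN; ring.
Qed.

End path_expansion.

(** * The sampled Poisson sign as a two-state chain *)

Section poisson_chain.
Context {R : realType} {d : measure_display} {T : measurableType d}.
Variables (P : probability T R) (N : R -> T -> nat).
Hypothesis HN : standard_poisson_process P N.
Variable h : R.
Hypothesis h_gt0 : 0 < h.

Let incr k w := (N (k.+1%:R * h) w - N (k%:R * h) w)%N.
Let odd_incr k : set T := [set w | odd (incr k w)].
Let q := fine (P (odd_incr 0)).

Let t_ge0 k : 0 <= k%:R * h. Proof. by rewrite mulr_ge0// ltW. Qed.

Let t_homo : {homo (fun k : nat => k%:R * h) : i j / (i <= j)%N >-> i <= j}.
Proof. by move=> i j ij; rewrite ler_pM2r// ler_nat. Qed.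

Let t_diff k : k.+1%:R * h - k%:R * h = h.
Proof. by rewrite -mulrBl -natrB// subSnn mul1r. Qed.

Let measurable_incr k : measurable_fun setT (incr k).
Proof. by apply: measurable_fun_subn; apply: (poisson_measurable HN). Qed.

Let measurable_incr_in k (A : set nat) : measurable (incr k @^-1` A).
Proof. by rewrite -[X in measurable X]setTI; exact: measurable_incr. Qed.

Let P_incr k i : P [set w | incr k w = i] = (poisson_pmf h i)%:E.
Proof.
have := poisson_increment_law HN (t_ge0 k) (_ : k%:R * h < k.+1%:R * h) i.
by rewrite t_diff; apply; rewrite ltr_pM2r// ltr_nat.
Qed.

Let measurable_odd_incr k : measurable (odd_incr k).
Proof. exact: (measurable_incr_in k (fun n => odd n)). Qed.

(** The probability is the Poisson mass of the odd integers, a series that does not involve [k];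
    hence the chain is homogeneous. *)
Let P_odd_incr k : P (odd_incr k) = q%:E.
Proof.
have H j : P (odd_incr j) = (\sum_(0 <= i <oo) (poisson_pmf h i.*2.+1)%:E)%E.
  have -> : odd_incr j = \bigcup_i [set w | incr j w = i.*2.+1].
    apply/seteqP; split => w /=.
      move=> ow; exists (incr j w)./2 => //=.
      by rewrite -[LHS]odd_double_half (ow : odd _ = true).
    by move=> [i _ /= E]; rewrite /odd_incr/= E /= odd_double.
  rewrite measure_bigcup//=.
  - rewrite (eq_eseriesl _ (Q := xpredT)); last by move=> i; rewrite in_setT.
    by apply: eq_eseriesr => i _; exact: P_incr.
  - by move=> i _; exact: (measurable_incr_in j [set i.*2.+1]).
  - apply/trivIsetP => i j' _ _ ij; apply/seteqP; split => // w [/= ->].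
    by move=> [] /double_inj /eqP; apply/negP.
by rewrite /q fineK ?H// -(H 0%N) fin_num_measure.
Qed.

Let P_even_incr k : P [set w | ~~ odd (incr k w)] = (1 - q)%:E.
Proof.
have -> : [set w | ~~ odd (incr k w)] = ~` odd_incr k.
  by apply/seteqP; split => w /negP.
by rewrite probability_setC// P_odd_incr EFinB.
Qed.

(** [q] is at least the probability [h * exp (- h)] of exactly one jump, and [1 - q] is at least the
    probability [exp (- h)] of no jump. This is the precision that [chain_step] asks for. *)
Lemma odd_jump_bound : h - h ^+ 2 <= q <= h.
Proof.
have pmfE i : poisson_pmf h i = h ^+ i / i`!%:R * expR (- h) by rewrite /poisson_pmf h_gt0.
have e1 := expR_ge1Dx (- h).
apply/andP; split.
- apply: (@le_trans _ _ (poisson_pmf h 1)).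
    by rewrite pmfE expr1 divr1; have := ler_wpM2l (ltW h_gt0) e1; lra.
  rewrite -lee_fin -(P_incr 0) -(P_odd_incr 0); apply: le_measure.
  + by rewrite inE; exact: (measurable_incr_in 0 [set 1%N]).
  + by rewrite inE.
  + by move=> w /=; rewrite /odd_incr/= => ->.
- suff : poisson_pmf h 0 <= 1 - q by rewrite pmfE expr0 fact0 divr1 mul1r; lra.
  rewrite -lee_fin -(P_incr 0) -(P_even_incr 0); apply: le_measure.
  + by rewrite inE; exact: (measurable_incr_in 0 [set 0%N]).
  + by rewrite inE; exact: (measurable_incr_in 0 (fun n => ~~ odd n)).
  + by move=> w /= ->.
Qed.

Let parity_path M w := [seq odd (incr k w) | k <- iota 0 M].

Let parity_pathE M bs : size bs = M ->
  [set w | parity_path M w = bs] =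
  \bigcap_(i : 'I_M) (incr i @^-1` [set n | odd n = nth false bs i]).
Proof.
move=> sbs; apply/seteqP; split => [w /= wE i _ /=|w /= H].
  by rewrite -wE (nth_map 0%N) ?size_iota// nth_iota.
apply: (@eq_from_nth _ false); rewrite ?size_map ?size_iota// => i iM.
rewrite (nth_map 0%N) ?size_iota// nth_iota// add0n.
exact: (H (Ordinal iM) I).
Qed.

Let measurable_parity_path M bs : measurable [set w | parity_path M w = bs].
Proof.
have [sbs|sbs] := eqVneq (size bs) M.
  by rewrite parity_pathE//; apply: fin_bigcap_measurable => // i _; exact: measurable_incr_in.
rewrite (_ : mkset _ = set0)//; apply/seteqP; split => // w /= wE.
by move: sbs; rewrite -wE size_map size_iota eqxx.
Qed.

Let P_parity_path M bs : size bs = M ->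
  P [set w | parity_path M w = bs] = (parity_weight q bs)%:E.
Proof.
move=> sbs; rewrite parity_pathE//.
have := poisson_independent_increments HN (n := M) (t_ge0 0) t_homo.
move=> /(_ (fun i => [set n | odd n = nth false bs i])) ->//.
rewrite /parity_weight (big_nth false) sbs big_mkord -prodEFin.
apply: eq_bigr => i _; case: (nth false bs i).
- exact: P_odd_incr.
- rewrite -(P_even_incr i); congr (P _).
  by apply/seteqP; split => w /=; [move=> ->|exact: negbTE].
Qed.

(** The path sum depends on the outcome only through the finite sequence of parities, and
    independence gives each sequence the weight that [chain_mgf_paths] attaches to it. *)
Lemma path_sum_mgf cs : (\int[P]_w
    (expR (path_sum (fun j => (-1) ^+ N (j%:R * h) w) cs 0))%:E =
  (chain_mgf q cs 1)%:E)%E.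
Proof.
set M := size cs.
have E w : (expR (path_sum (fun j => (-1) ^+ N (j%:R * h) w) cs 0))%:E =
    (\sum_(bs <- bool_seqs M) (expR (sign_sum cs bs 1))%:E *
       (\1_[set w | parity_path M w = bs] w)%:E)%E.
  rewrite (path_sumE (b := fun k => odd (incr k w))); last first.
    move=> k; rewrite signr_odd -exprD subnK//.
    by apply: (poisson_nondecreasing HN) => //; exact: t_homo.
  rewrite mul0r (poisson_start HN) expr0 -/(parity_path M w).
  rewrite (bigD1_seq (parity_path M w)) ?uniq_bool_seqs//=; last first.
    by rewrite mem_bool_seqs size_map size_iota.
  rewrite indicE mem_set//= mule1 big1 ?adde0// => bs /negP bsw.
  rewrite indicE memNset ?mule0//= => E; apply: bsw; exact/eqP.
under eq_integral do rewrite E.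
rewrite ge0_integral_sum//; last first.
  move=> bs; apply: emeasurable_funM => //.
  by apply/measurable_EFinP; exact: measurable_indic.
rewrite chain_mgf_paths -sumEFin !big_seq; apply: eq_bigr => bs.
rewrite mem_bool_seqs => /eqP sbs.
rewrite ge0_integralZl//; last first.
  by apply/measurable_EFinP; exact: measurable_indic.
rewrite (integral_indic P measurableT (measurable_parity_path M bs)) setIT.
by rewrite mulrC EFinM; congr (_ * _)%E; exact: P_parity_path.
Qed.

End poisson_chain.

(** * The telegraph signal in continuous time *)

Section telegraph.
Context {R : realType} {d : measure_display} {T : measurableType d}.
Variables (P : probability T R) (N : R -> T -> nat).
Hypothesis HN : standard_poisson_process P N.
Notation mu := (@lebesgue_measure R).

Definition telegraph (tau : R) (w : T) (r : R) : R := (-1) ^+ N (tau * r) w.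

Lemma telegraph_norm tau w r : `|telegraph tau w r| = 1.
Proof. by rewrite /telegraph normrX normrN1 expr1n. Qed.

Lemma cos_natpi n : cos (n%:R * pi) = (-1) ^+ n :> R.
Proof.
elim: n => [|n IH]; first by rewrite mul0r cos0.
by rewrite -natr1 mulrDl mul1r cosDpi IH exprS mulN1r.
Qed.

Lemma telegraph_ball tau w : 0 < tau -> unit_ball (telegraph tau w).
Proof.
move=> tau0; split; last by move=> r _; rewrite telegraph_norm.
(* [N] is unconstrained at negative times, hence the [max]; it makes [M] monotone on the whole
   line. *)
pose M (r : R) : R := (N (tau * Num.max 0 r) w)%:R.
have mM : measurable_fun (`[0, 1] : set R) M.
  apply: nondecreasing_measurable => // r s rs; rewrite /M ler_nat.
  apply: (poisson_nondecreasing HN); first by rewrite mulr_ge0 ?le_max ?lexx// ltW.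
  by rewrite ler_pM2l// ge_max !le_max lexx rs orbT.
(* [(-1) ^ n = cos (n pi)] reduces measurability to that of the monotone [M]. *)
apply: (eq_measurable_fun (fun r => cos (M r * pi))).
  move=> r; rewrite inE/= in_itv/= => /andP[r0 _].
  by rewrite cos_natpi /telegraph max_r.
apply: (@measurableT_comp _ _ _ _ _ _ (@cos R)).
  exact: continuous_measurable_fun (@continuous_cos R).
by apply: measurable_funM.
Qed.

(** Riemann sum of the cell integral at the right ends of [m] equal subintervals, in a form matching
    [path_sum] with time step [tau / (n m)]. *)
Definition cell_sum tau n m i (w : T) : R :=
  (n%:R * m%:R)^-1 * \sum_(k < m) (-1) ^+ N ((i * m + k.+1)%:R * (tau / (n%:R * m%:R))) w.

(** Without a jump in between, the two terms agree; otherwise the jump count is at least 1 and each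
    term is at most [b - a]. Using the count itself as the bound makes the errors telescope when
    summed over the subintervals of a cell. *)
Lemma telegraph_const_int tau w (a b : R) : 0 < tau -> 0 <= a -> a <= b -> b <= 1 ->
  `|\int[mu]_(r in `[a, b]) telegraph tau w r - (b - a) * telegraph tau w b| <=
  2 * (b - a) * ((N (tau * b) w)%:R - (N (tau * a) w)%:R).
Proof.
move=> tau0 a0 ab b1.
have muab : fine (mu `[a, b]%classic) = b - a.
  rewrite lebesgue_measure_itv/= lte_fin; case: ltP => //= ba.
  by apply/esym/eqP; rewrite subr_eq0 eq_le ab ba.
have sub01 : `[a, b]%classic `<=` `[(0 : R), 1]%classic.
  by move=> r /=; rewrite !in_itv/= => /andP[? ?]; apply/andP; split; lra.
have ba : 0 <= b - a by rewrite subr_ge0.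
have mono (s t : R) : 0 <= s -> s <= t -> (N (tau * s) w <= N (tau * t) w)%N.
  move=> s0 st; apply: (poisson_nondecreasing HN); first by rewrite mulr_ge0// ltW.
  by rewrite ler_pM2l.
have [E|NE] := eqVneq (N (tau * a) w) (N (tau * b) w).
  have -> : \int[mu]_(r in `[a, b]) telegraph tau w r =
      \int[mu]_(r in `[a, b]) telegraph tau w b.
    apply: eq_Rintegral => r; rewrite inE/= in_itv/= => /andP[ar rb].
    rewrite /telegraph; congr (_ ^+ _); apply/eqP; rewrite eqn_leq.
    by rewrite mono ?(le_trans a0)//= -E mono.
  by rewrite Rintegral_cst// muab mulrC subrr normr0 E subrr mulr0.
have H1 : 1 <= (N (tau * b) w)%:R - (N (tau * a) w)%:R :> R.
  rewrite -natrB ?mono// ler1n subn_gt0 ltn_neqAle NE.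
  exact: mono.
have H2 : `|\int[mu]_(r in `[a, b]) telegraph tau w r| <= b - a.
  have ti : mu.-integrable `[a, b] (EFin \o telegraph tau w).
    exact: (unit_ball_integrable (telegraph_ball w tau0)).
  apply: le_trans (le_normr_Rintegral _ ti) _ => //.
  rewrite -muab -[leRHS]mul1r -Rintegral_cst//.
  apply: le_Rintegral => //.
  - exact: (integrable_norm ti).
  - apply: (@bounded_integrable _ _ _ _ _ _ 1) => //.
      exact: sub_mu01_fin.
    by move=> x _; rewrite normr1.
  - by move=> x _; rewrite telegraph_norm.
apply: le_trans (ler_normB _ _) _.
rewrite normrM telegraph_norm mulr1 (ger0_norm ba).
apply: (@le_trans _ _ (2 * (b - a) * 1)).
  by move: H2; clear; move: `|_| (b - a) => x y; lra.
by rewrite ler_wpM2l// mulr_ge0.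
Qed.

Lemma cell_sum_dist tau n m i w : 0 < tau -> (i < n)%N ->
  `|cell_int n i (telegraph tau w) - cell_sum tau n m.+1 i w| <=
  2 / n%:R * ((N (tau * (i.+1%:R / n%:R)) w)%:R - (N (tau * (i%:R / n%:R)) w)%:R)
     * m.+1%:R^-1.
Proof.
move=> tau0 i_n.
have n0 : n%:R != 0 :> R by rewrite pnatr_eq0; case: n i_n.
have n0' : 0 < n%:R :> R by rewrite lt0r n0 /=.
pose a (k : nat) : R := (i * m.+1 + k)%:R / (n%:R * m.+1%:R).
have a_nd : nondecreasing_seq a.
  move=> k l kl; rewrite ler_pM2r ?ler_nat ?leq_add2l//.
  by rewrite invr_gt0 mulr_gt0.
have a0 : a 0%N = i%:R / n%:R.
  by rewrite /a addn0 natrM -mulf_div divff ?mulr1// pnatr_eq0.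
have am : a m.+1 = i.+1%:R / n%:R.
  by rewrite /a -[X in (_ + X)%N]mul1n -mulnDl addn1 natrM -mulf_div divff ?mulr1// pnatr_eq0.
have a_diff k : a k.+1 - a k = (n%:R * m.+1%:R)^-1.
  by rewrite /a -mulrBl -natrB ?leq_add2l// subnDl subSnn mul1r.
have cs01 := @cell_sub R n i i_n.
rewrite /cell_int -a0 -am (@Rintegral_chain _ _ a)//; last first.
  apply: (unit_ball_integrable (telegraph_ball w tau0)) => //.
  by rewrite a0 am.
have -> : cell_sum tau n m.+1 i w =
    \sum_(k < m.+1) (a k.+1 - a k) * telegraph tau w (a k.+1).
  rewrite /cell_sum mulr_sumr; apply: eq_bigr => k _; rewrite a_diff.
  by rewrite /telegraph /a mulrCA.
rewrite -sumrB; apply: le_trans (ler_norm_sum _ _ _) _.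
apply: (@le_trans _ _ (\sum_(k < m.+1) 2 * (n%:R * m.+1%:R)^-1 *
    ((N (tau * a k.+1) w)%:R - (N (tau * a k) w)%:R))).
  apply: ler_sum => k _; rewrite -(a_diff k); apply: telegraph_const_int => //.
  - by rewrite divr_ge0.
  - exact: a_nd.
  - have : a k.+1 <= a m.+1 by exact: a_nd.
    rewrite am => /le_trans; apply.
    by rewrite ler_pdivrMr// mul1r ler_nat.
rewrite -mulr_sumr -(big_mkord xpredT (fun k => (N (tau * a k.+1) w)%:R - (N (tau * a k) w)%:R)).
rewrite (telescope_sumr (fun k => (N (tau * a k) w)%:R))//.
by rewrite le_eqVlt; apply/orP; left; apply/eqP; rewrite [(n%:R * m.+1%:R)^-1]invfM; ring.
Qed.

Lemma cell_sum_cvg tau n i w : 0 < tau -> (i < n)%N ->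
  cell_sum tau n m.+1 i w @[m --> \oo] --> cell_int n i (telegraph tau w).
Proof.
move=> tau0 i_n.
set c := 2 / n%:R * ((N (tau * (i.+1%:R / n%:R)) w)%:R - (N (tau * (i%:R / n%:R)) w)%:R) : R.
have c_cvg : c * m.+1%:R^-1 @[m --> \oo] --> (0 : R).
  by rewrite -[X in _ --> X](mulr0 c); apply: cvgM; [exact: cvg_cst|exact: cvg_harmonic].
apply/cvgrPdist_le => e e0.
move/cvgrPdist_le : c_cvg => /(_ e e0); apply: filterS => m H.
apply: le_trans (cell_sum_dist m w tau0 i_n) _.
by apply: le_trans (ler_norm _) _; rewrite -normrN -[X in `|X|]add0r.
Qed.

Lemma measurable_cell_sum tau n m i : 0 < tau -> measurable_fun setT (cell_sum tau n m i).
Proof.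
move=> tau0; apply: measurable_funM => //; apply: measurable_sum => k.
have t0 : 0 <= (i * m + k.+1)%:R * (tau / (n%:R * m%:R)).
  by rewrite !mulr_ge0 ?invr_ge0 ?mulr_ge0// ltW.
by apply: (@measurableT_comp _ _ _ _ _ _ (fun j : nat => (-1) ^+ j : R)) => //;
  exact: (poisson_measurable HN).
Qed.

Lemma measurable_cell_int tau n i : 0 < tau -> (i < n)%N ->
  measurable_fun setT (fun w => cell_int n i (telegraph tau w)).
Proof.
move=> tau0 i_n.
apply: (@measurable_fun_cvg _ _ _ _ (fun m => cell_sum tau n m.+1 i)) => //.
- by move=> m; exact: measurable_cell_sum.
- by move=> w _; exact: cell_sum_cvg.
Qed.

Lemma path_sum_cell_sum tau n m (lam : nat -> R) w : (0 < n)%N ->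
  path_sum (fun j => (-1) ^+ N (j%:R * (tau / (n%:R * m.+1%:R))) w)
    (flatten [seq nseq m.+1 (tau / (n%:R * m.+1%:R) * l) | l <- mkseq lam n]) 0 =
  tau * \sum_(i < n) lam i * cell_sum tau n m.+1 i w.
Proof.
move=> n0; rewrite path_sum_blocks size_mkseq mulr_sumr; apply: eq_bigr => i _.
rewrite nth_mkseq// /cell_sum; set c := (n%:R * _)^-1.
rewrite (_ : \sum_(k < m.+1) (-1) ^+ N ((0 + i * m.+1 + k.+1)%:R * (tau * c)) w =
  \sum_(k < m.+1) (-1) ^+ N ((i * m.+1 + k.+1)%:R * (tau * c)) w); first by ring.
by apply: eq_bigr => k _; rewrite add0n.
Qed.

Lemma cell_sum_norm tau n m i w : (0 < n)%N -> `|cell_sum tau n m.+1 i w| <= n%:R^-1.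
Proof.
move=> n0; have n0' : n%:R != 0 :> R by rewrite pnatr_eq0 -lt0n.
rewrite normrM ger0_norm ?invr_ge0 ?mulr_ge0//.
apply: (@le_trans _ _ ((n%:R * m.+1%:R)^-1 * m.+1%:R)).
  rewrite ler_wpM2l ?invr_ge0 ?mulr_ge0//.
  apply: le_trans (ler_norm_sum _ _ _) _.
  under eq_bigr do rewrite normrX normrN1 expr1n.
  by rewrite sumr_const card_ord.
by rewrite invfM divfK// pnatr_eq0.
Qed.

(** For the sampled signal the chain formula is exact, with step [h = tau / (n m)]. Dominated
    convergence lets [m] tend to infinity at fixed [tau]. The accumulated error
    [m * C * h^2 = tau / n * C * h] is eventually at most 1, whence the factor [expR 1] in a
    constant that does not depend on [tau]. *)
Lemma telegraph_mgf n (lam : nat -> R) : (0 < n)%N -> exists2 V : R, 1 <= V &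
  forall tau, 0 < tau ->
  ((V^-1 * expR (tau / n%:R * \sum_(i < n) Lam (lam i)))%:E <=
   \int[P]_w (expR (tau * \sum_(i < n) lam i * cell_int n i (telegraph tau w)))%:E <=
   (V * expR (tau / n%:R * \sum_(i < n) Lam (lam i)))%:E)%E.
Proof.
move=> n0; have n0' : 0 < n%:R :> R by rewrite ltr0n.
have [C [V [C1 V1 H]]] := chain_mgf_bound (mkseq lam n).
exists (V * expR 1).
  rewrite -[leLHS]mulr1 ler_pM//; apply: le_trans (expR_ge1Dx 1); lra.
move=> tau tau0.
pose h m : R := tau / (n%:R * m.+1%:R).
have h0 m : 0 < h m by rewrite divr_gt0// mulr_gt0// ltr0n.
pose F m w : \bar R := (expR (tau * \sum_(i < n) lam i * cell_sum tau n m.+1 i w))%:E.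
pose F0 w : \bar R :=
  (expR (tau * \sum_(i < n) lam i * cell_int n i (telegraph tau w)))%:E.
pose G : R := expR (tau * \sum_(i < n) `|lam i| * n%:R^-1).
have F_cvg : (\int[P]_w F m w)%E @[m --> \oo] --> (\int[P]_w F0 w)%E.
  have [] := @dominated_convergence _ _ _ P setT measurableT F F0 (cst G%:E).
  - move=> m; apply/measurable_EFinP; apply: measurableT_comp => //.
    apply: measurable_funM => //; apply: measurable_sum => i.
    by apply: measurable_funM => //; exact: measurable_cell_sum.
  - apply/measurable_EFinP; apply: measurableT_comp => //.
    apply: measurable_funM => //; apply: measurable_sum => i.
    by apply: measurable_funM => //; exact: measurable_cell_int.
  - apply: aeW => w _; apply: cvg_EFin; first exact: nearW.
    apply: continuous_cvg; first exact: continuous_expR.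
    apply: cvgM; first exact: cvg_cst.
    apply: (cvg_big add_continuous) => // i _; apply: cvgM; first exact: cvg_cst.
    exact: cell_sum_cvg.
  - apply: (@bounded_integrable _ _ _ P setT (cst G) `|G|) => //.
    exact: (le_lt_trans (probability_le1 P measurableT) (ltry 1)).
  - apply: aeW => w m _; rewrite /= ger0_norm ?expR_ge0// lee_fin ler_expR ler_pM2l//.
    apply: ler_sum => i _; apply: le_trans (ler_norm _) _.
    by rewrite normrM ler_wpM2l// cell_sum_norm.
  - by [].
pose q m := fine (P [set w | odd (N (1%:R * h m) w - N (0%:R * h m) w)]).
have F_chain m : (\int[P]_w F m w)%E = (chain_mgf (q m)
    (flatten [seq nseq m.+1 (h m * l) | l <- mkseq lam n]) 1)%:E.
  rewrite -(path_sum_mgf HN (h0 m)); apply: eq_integral => w _.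
  by rewrite /F -path_sum_cell_sum.
have sumE : \sum_(l <- mkseq lam n) Lam l = \sum_(i < n) Lam (lam i).
  by rewrite /mkseq big_map -[X in iota 0 X]subn0 -/(index_iota 0 n) big_mkord.
have F_bound : \forall m \near \oo,
  (((V * expR 1)^-1 * expR (tau / n%:R * \sum_(i < n) Lam (lam i)))%:E <=
    \int[P]_w F m w <=
    (V * expR 1 * expR (tau / n%:R * \sum_(i < n) Lam (lam i)))%:E)%E.
  (* This one limit controls both the condition [4 * C * h <= 1] and the accumulated error
     [tau / n * C * h]. *)
  have h_cvg : (4 + tau / n%:R) * C * h m @[m --> \oo] --> (0 : R).
    rewrite -[X in _ --> X](mulr0 ((4 + tau / n%:R) * C * (tau / n%:R))).
    rewrite (_ : (fun m => _) = fun m =>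
       (4 + tau / n%:R) * C * (tau / n%:R) * harmonic m); last first.
      by apply/funext => m; rewrite /h /harmonic/= invfM; ring.
    by apply: cvgM; [exact: cvg_cst|exact: cvg_harmonic].
  move/cvgrPdist_le : h_cvg => /(_ 1 ltr01); apply: filterS => m.
  have C0 : 0 <= C by exact: le_trans C1.
  have hm0 := ltW (h0 m).
  have A1 : 0 <= tau / n%:R * C * h m.
    by rewrite mulr_ge0// mulr_ge0// divr_ge0// ltW.
  have A2 : 0 <= 4 * C * h m by rewrite mulr_ge0// mulr_ge0.
  rewrite sub0r normrN 2!mulrDl ger0_norm ?addr_ge0// => hm.
  have /andP[B1 B2] := H (h m) (q m) m.+1 1 (h0 m) ltac:(lra)
    (odd_jump_bound HN (h0 m)) (normr1 _).
  have mh : m.+1%:R * h m = tau / n%:R.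
    by rewrite /h invfM mulrCA [X in _ * X]mulrCA divff ?mulr1// pnatr_eq0.
  have mCh : m.+1%:R * C * h m ^+ 2 = tau / n%:R * C * h m.
    by rewrite -mh; ring.
  rewrite sumE mh mCh in B1 B2.
  have ch1 : tau / n%:R * C * h m <= 1 by lra.
  rewrite F_chain !lee_fin; apply/andP; split.
    apply: le_trans B1; rewrite expRD invfM -[leLHS]mulrA ler_wpM2l ?invr_ge0 ?(le_trans ler01)//.
    by rewrite mulrC ler_wpM2l ?expR_ge0// -expRN ler_expR lerN2.
  apply: le_trans B2 _; rewrite expRD -[leRHS]mulrA ler_wpM2l ?(le_trans ler01)//.
  by rewrite mulrC ler_wpM2r ?expR_ge0// ler_expR.
apply/andP; split.
- by apply: (cvge_to_ge F_cvg); apply: filterS F_bound => m /andP[].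
- by apply: (cvge_to_le F_cvg); apply: filterS F_bound => m /andP[].
Qed.

End telegraph.

(** * Large deviations of the cell integrals *)

Section tails.
Context {R : realType} {d : measure_display} {T : measurableType d}.
Variables (P : probability T R) (N : R -> T -> nat).
Hypothesis HN : standard_poisson_process P N.
Local Notation S tau n i w := (cell_int n i (telegraph N tau w)).

Lemma probability_le_integral (A : set T) (g : T -> R) : measurable A ->
  measurable_fun setT g -> (forall w, 0 <= g w) -> (forall w, A w -> 1 <= g w) ->
  (P A <= \int[P]_w (g w)%:E)%E.
Proof.
move=> mA mg g0 g1.
have -> : P A = (\int[P]_w (\1_A w)%:E)%E by rewrite (integral_indic P measurableT mA) setIT.
apply: ge0_le_integral => //.
- by apply/measurable_EFinP; exact: measurable_indic.
- exact/measurable_EFinP.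
- move=> w _; rewrite lee_fin indicE; case: (boolP (w \in A)) => // /set_mem.
  exact: g1.
Qed.

Lemma measurable_exp_cell tau n (lam : nat -> R) : 0 < tau ->
  measurable_fun setT (fun w => expR (tau * \sum_(i < n) lam i * S tau n i w)).
Proof.
move=> tau0; apply: measurableT_comp => //; apply: measurable_funM => //.
apply: measurable_sum => i; apply: measurable_funM => //.
exact: (measurable_cell_int HN).
Qed.

Lemma measurable_cell_rate tau n c : 0 < tau ->
  measurable [set w | c <= n%:R^-1 * \sum_(i < n) Lst (n%:R * S tau n i w)].
Proof.
move=> tau0.
have mf : measurable_fun setT (fun w => n%:R^-1 * \sum_(i < n) Lst (n%:R * S tau n i w)).
  apply: measurable_funM => //; apply: measurable_sum => i.
  apply: (@measurableT_comp _ _ _ _ _ _ (@Lst R)).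
    by apply: measurable_Lst.
  by apply: measurable_funM => //; exact: (measurable_cell_int HN).
rewrite (_ : mkset _ = setT `&`
  (fun w => n%:R^-1 * \sum_(i < n) Lst (n%:R * S tau n i w)) @^-1` `[c, +oo[).
  by apply: mf => //; exact: measurable_itv.
by rewrite setTI; apply/seteqP; split => w /=; rewrite in_itv/= andbT.
Qed.

Lemma cell_int_norm (n i : nat) (phi : R -> R) : unit_ball phi -> (i < n)%N ->
  `|n%:R * cell_int n i phi| <= 1.
Proof.
move=> B i_n; have n0 : 0 < n%:R :> R by rewrite ltr0n; case: n i_n.
rewrite normrM ger0_norm// mulrC -ler_pdivlMr// div1r.
have sub := @cell_sub R n i i_n.
have fi : lebesgue_measure.-integrable `[i%:R / n%:R, i.+1%:R / n%:R] (EFin \o phi).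
  exact: (unit_ball_integrable B).
apply: le_trans (le_normr_Rintegral _ fi) _ => //.
have mE : fine (lebesgue_measure (`[i%:R / n%:R, i.+1%:R / n%:R]%classic : set R)) = n%:R^-1.
  by rewrite mu_cell//; case: n i_n {n0 sub fi}.
apply: (@le_trans _ _ (\int[lebesgue_measure]_(r in
    `[i%:R / n%:R, i.+1%:R / n%:R]) (1 : R))); last by rewrite Rintegral_cst// mul1r mE.
apply: le_Rintegral => //.
- exact: (integrable_norm fi).
- apply: (@bounded_integrable _ _ _ _ _ _ 1) => //; first exact: sub_mu01_fin.
  by move=> x _; rewrite normr1.
- by move=> x /sub; exact: B.2.
Qed.

Lemma measurable_cell_box tau n (x : nat -> R) rho : 0 < tau ->
  measurable [set w | forall i, (i < n)%N -> `|S tau n i w - x i| <= rho].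
Proof.
move=> tau0.
rewrite (_ : mkset _ = \bigcap_(i : 'I_n) [set w | `|S tau n i w - x i| <= rho]); last first.
  apply/seteqP; split => [w Gw i _|w Gw i i_n]; first exact: Gw.
  exact: (Gw (Ordinal i_n) I).
apply: fin_bigcap_measurable => // i _.
have mf : measurable_fun setT (fun w => `|S tau n i w - x i|).
  apply: measurableT_comp => //; apply: measurable_funB => //.
  exact: (measurable_cell_int HN).
rewrite (_ : mkset _ = setT `&` (fun w => `|S tau n i w - x i|) @^-1` `]-oo, rho]).
  by apply: mf => //; exact: measurable_itv.
by rewrite setTI; apply/seteqP; split => w /=; rewrite in_itv/=.
Qed.

(** Each outcome selects, cell by cell, a nearly optimal tilt from the grid, so the indicator of the
    event is at most the sum of the exponentials over all assignments of tilts to cells. Their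
    number does not depend on [tau]. *)
Lemma upper_tail n (c e : R) : 0 < e -> exists2 C : R, 0 < C &
  forall tau, 0 < tau ->
  (P [set w | (c <= n.+1%:R^-1 * \sum_(i < n.+1) Lst (n.+1%:R * S tau n.+1 i w))%R]
   <= (C * expR (- (tau * (c - e))))%:E)%E.
Proof.
move=> e0; have [q Hq] := Lam_grid e0.
have n0 : 0 < n.+1%:R :> R by rewrite ltr0n.
pose J := {ffun 'I_n.+1 -> 'I_(size q)}.
pose lam (j : J) (i : nat) := q`_(j (inord i)).
pose V j := sval (cid2 (telegraph_mgf HN (lam j) (ltn0Sn n))).
have V1 j : 1 <= V j by rewrite /V; case: cid2.
have HV j := (svalP (cid2 (telegraph_mgf HN (lam j) (ltn0Sn n)))).2.
exists (1 + \sum_j V j).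
  by rewrite ltr_wpDr// sumr_ge0// => j _; rewrite (le_trans ler01).
move=> tau tau0.
set D := [set w | _].
pose L j := tau / n.+1%:R * \sum_(i < n.+1) Lam (lam j i).
(* Normalized so that, on the event, [1 <= g j w] as soon as [j] is nearly optimal for [w], while
   the integral of [g j] is at most [V j * expR (- (tau * (c - e)))]. *)
pose g j w := expR (- (tau * (c - e)) - L j) *
  expR (tau * \sum_(i < n.+1) lam j i * S tau n.+1 i w).
have mg j : measurable_fun setT (g j).
  by apply: measurable_funM => //; exact: measurable_exp_cell.
have g0 j w : 0 <= g j w by rewrite mulr_ge0 ?expR_ge0.
apply: (@le_trans _ _ (\int[P]_w (\sum_j g j w)%:E)%E).
  apply: probability_le_integral; first exact: measurable_cell_rate.
  - by apply: measurable_sum => j; exact: mg.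
  - by move=> w; apply: sumr_ge0.
  move=> w Dw.
  have H i : exists k : 'I_(size q), Lst (n.+1%:R * S tau n.+1 (i : 'I_n.+1) w) - e
      <= q`_k * (n.+1%:R * S tau n.+1 i w) - Lam q`_k.
    have [|l lq Hl] := Hq (n.+1%:R * S tau n.+1 i w).
      by apply: cell_int_norm => //; exact: (telegraph_ball HN).
    have k_q : (index l q < size q)%N by rewrite index_mem.
    by exists (Ordinal k_q); rewrite /= nth_index.
  have [f Hf] := choice H.
  pose j : J := [ffun i => f i].
  rewrite (bigD1 j)//=; apply: (@le_trans _ _ (g j w)); last first.
    by rewrite lerDl sumr_ge0.
  rewrite /g -expRD -[leLHS]expR0 ler_expR /L.
  have : c - e <= n.+1%:R^-1 * \sum_(i < n.+1)
      (lam j i * (n.+1%:R * S tau n.+1 i w) - Lam (lam j i)).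
    have : c - e <= n.+1%:R^-1 * \sum_(i < n.+1) (Lst (n.+1%:R * S tau n.+1 i w) - e).
      rewrite sumrB sumr_const card_ord mulrBr -[e *+ _]mulr_natl mulrA.
      by rewrite mulVf ?gt_eqF// mul1r lerD2r.
    move=> /le_trans; apply; rewrite ler_wpM2l ?invr_ge0// ler_sum// => i _.
    by rewrite /lam inord_val ffunE.
  have E1 : \sum_(i < n.+1) (lam j i * (n.+1%:R * S tau n.+1 i w) - Lam (lam j i)) =
    \sum_(i < n.+1) lam j i * (n.+1%:R * S tau n.+1 i w) - \sum_(i < n.+1) Lam (lam j i).
    by rewrite sumrB.
  rewrite E1 mulrBr => H2.
  have E2 : \sum_(i < n.+1) lam j i * (n.+1%:R * S tau n.+1 i w) =
    n.+1%:R * \sum_(i < n.+1) lam j i * S tau n.+1 i w.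
    by rewrite mulr_sumr; apply: eq_bigr => i _; ring.
  rewrite E2 mulrA mulVf ?gt_eqF// mul1r -(ler_pM2l tau0) in H2.
  have E3 X Y : tau * (X - n.+1%:R^-1 * Y) = tau * X - tau / n.+1%:R * Y by ring.
  rewrite E3 in H2.
  rewrite -[leRHS]addrA [leRHS]addrC subr_ge0 [leRHS]addrC.
  exact: H2.
under eq_integral do rewrite -sumEFin.
rewrite ge0_integral_sum//; [|by move=> j; apply/measurable_EFinP; exact: mg
                             |by move=> j w _; rewrite lee_fin].
apply: (@le_trans _ _ (\sum_j (V j * expR (- (tau * (c - e))))%:E)%E).
  apply: lee_sum => j _.
  under eq_integral do rewrite EFinM.
  rewrite ge0_integralZl//; last first.
    by apply/measurable_EFinP; exact: measurable_exp_cell.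
  have /andP[_ H] := HV j tau tau0.
  have e0' : (0 <= (expR (- (tau * (c - e)) - L j))%:E)%E by rewrite lee_fin expR_ge0.
  apply: le_trans (lee_wpmul2l e0' H) _.
  rewrite -EFinM lee_fin mulrCA -expRD -/(V j) -/(L j) subrK.
  by [].
rewrite sumEFin lee_fin -mulr_suml ler_wpM2r ?expR_ge0// lerDr.
exact: ler01.
Qed.

(** A change of measure in disguise. The integral of the exponential at the tilts [slope (y i)] is
    bounded below by [telegraph_mgf], and for large [tau] at most half of this bound comes from
    outside the box, by the quadratic estimate [Lam_slopeD]. Inside the box the exponential exceeds
    its value at the center by a factor of at most [exp (tau * rho * \sum_i |slope (y i)|)], which
    explains the second term of the exponent. *)
Lemma lower_tail n (y : nat -> R) (rho : R) : 0 < rho ->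
  (forall i, (i < n.+1)%N -> `|y i| < 1) -> exists2 c : R, 0 < c &
  \forall tau \near +oo,
  ((c * expR (- (tau * (n.+1%:R^-1 * \sum_(i < n.+1) Lst (y i)
       + rho * \sum_(i < n.+1) `|slope (y i)|))))%:E
   <= P [set w | forall i, (i < n.+1)%N ->
          (`|S tau n.+1 i w - y i / n.+1%:R| <= rho)%R])%E.
Proof.
move=> rho0 y1.
have n0 : 0 < n.+1%:R :> R by rewrite ltr0n.
pose lam i := slope (y i).
(* Maximizes the gain [k * rho - k ^+ 2 / (2 * n.+1)] of a perturbed tilt; the maximum is
   [n.+1 * rho ^+ 2 / 2]. *)
pose k := n.+1%:R * rho.
have k0 : 0 < k by rewrite mulr_gt0.
pose sg (b : bool) : R := (-1) ^+ b.
pose lam' (j : 'I_n.+1 * bool) (i : nat) := lam i + (if i == j.1 :> nat then sg j.2 * k else 0).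
have [V V1 HV] := telegraph_mgf HN lam (ltn0Sn n).
pose W j := sval (cid2 (telegraph_mgf HN (lam' j) (ltn0Sn n))).
have W1 j : 1 <= W j by rewrite /W; case: cid2.
have HW j := (svalP (cid2 (telegraph_mgf HN (lam' j) (ltn0Sn n)))).2.
have V0 : 0 < V by exact: lt_le_trans V1.
have W0 : 0 <= \sum_j W j by rewrite sumr_ge0// => j _; rewrite (le_trans ler01).
have lam'E j (z : nat -> R) : \sum_(i < n.+1) lam' j i * z i =
    \sum_(i < n.+1) lam i * z i + sg j.2 * k * z j.1.
  rewrite (eq_bigr (fun i : 'I_n.+1 => lam i * z i +
      (if i == j.1 then sg j.2 * k * z i else 0))); last first.
    move=> i _; rewrite /lam' mulrDl (_ : (i == j.1 :> nat) = (i == j.1))//.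
    by case: ifP => // _; rewrite mul0r.
  by rewrite big_split/= -big_mkcond/= big_pred1_eq.
have Lam'E j : \sum_(i < n.+1) Lam (lam' j i) <=
    \sum_(i < n.+1) Lam (lam i) + (sg j.2 * k * y j.1 + k ^+ 2 / 2).
  rewrite (bigD1 j.1)//= [X in _ <= X + _](bigD1 j.1)//=.
  rewrite (eq_bigr (fun i : 'I_n.+1 => Lam (lam i))); last first.
    by move=> i /negbTE ij; rewrite /lam' [_ == _]ij addr0.
  rewrite [leRHS]addrAC lerD2r /lam' eqxx.
  have := Lam_slopeD (sg j.2 * k) (y1 j.1 (ltn_ord _)).
  have -> : (sg j.2 * k) ^+ 2 = k ^+ 2 by rewrite exprMn /sg sqrr_sign mul1r.
  by rewrite addrA.
exists (V^-1 / 2); first by rewrite divr_gt0// invr_gt0.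
(* Beyond this threshold the perturbed tilts contribute at most half of the lower bound
   [V^-1 * expR L], by [expR (- x) <= x^-1]. *)
exists (4 * V * (1 + \sum_j W j) / (n.+1%:R * rho ^+ 2)).
split; first exact: num_real.
move=> tau tau_big.
have nr0 : 0 < n.+1%:R * rho ^+ 2 by rewrite mulr_gt0// exprn_gt0.
have tau0 : 0 < tau.
  by apply: le_lt_trans tau_big; rewrite divr_ge0 ?ltW// !mulr_gt0// ltr_wpDr.
set A := n.+1%:R^-1 * \sum_(i < n.+1) _ + _.
set G := [set w | _].
set L := tau / n.+1%:R * \sum_(i < n.+1) Lam (lam i).
pose B := \sum_(i < n.+1) lam i * (y i / n.+1%:R) + rho * \sum_(i < n.+1) `|lam i|.
have BA : L - tau * B = - (tau * A).
  rewrite /L /B /A.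
  have -> : \sum_(i < n.+1) Lst (y i) = \sum_(i < n.+1) (lam i * y i - Lam (lam i)).
    by apply: eq_bigr => i _; rewrite Lam_dual// y1.
  have -> : \sum_(i < n.+1) lam i * (y i / n.+1%:R) =
      n.+1%:R^-1 * \sum_(i < n.+1) lam i * y i.
    by rewrite mulr_sumr; apply: eq_bigr => i _; ring.
  have -> : \sum_(i < n.+1) (lam i * y i - Lam (lam i)) =
      \sum_(i < n.+1) lam i * y i - \sum_(i < n.+1) Lam (lam i) by rewrite sumrB.
  have -> : \sum_(i < n.+1) `|slope (y i)| = \sum_(i < n.+1) `|lam i| by [].
  ring.
have mG : measurable G by exact: measurable_cell_box.
pose h (j : 'I_n.+1 * bool) := tau * (sg j.2 * k * (y j.1 / n.+1%:R) + k * rho).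
pose f w := expR (tau * \sum_(i < n.+1) lam i * S tau n.+1 i w).
pose g (j : 'I_n.+1 * bool) w := expR (- h j) *
  expR (tau * \sum_(i < n.+1) lam' j i * S tau n.+1 i w).
have mg j : measurable_fun setT (g j).
  by apply: measurable_funM => //; exact: measurable_exp_cell.
have g0 j w : 0 <= g j w by rewrite mulr_ge0 ?expR_ge0.
(* Off [G] some cell integral deviates, and there the exponential at the perturbed
   tilt of that cell dominates the one at the optimal tilt. *)
have fle w : f w <= expR (tau * B) * \1_G w + \sum_j g j w.
  rewrite indicE; case: (boolP (w \in G)) => [/set_mem Gw|/negP nG].
    rewrite mulr1 -[leLHS]addr0 lerD ?sumr_ge0// ler_expR ler_pM2l//.
    rewrite /B mulr_sumr -big_split/= ler_sum// => i _.
    have H := Gw i (ltn_ord i).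
    rewrite -lerBlDl -mulrBr; apply: le_trans (ler_norm _) _.
    by rewrite normrM mulrC ler_wpM2r.
  rewrite mulr0 add0r.
  have [i [i_n Hi]] : exists i, (i < n.+1)%N /\ rho < `|S tau n.+1 i w - y i / n.+1%:R|.
    apply: contrapT => H; apply: nG; apply/mem_set => i i_n.
    by rewrite leNgt; apply/negP => Hi; apply: H; exists i.
  pose b := S tau n.+1 i w - y i / n.+1%:R < 0.
  pose j := (Ordinal i_n, b).
  rewrite (bigD1 j)//= -[leLHS]addr0 lerD ?sumr_ge0// /g -expRD ler_expR
      (lam'E j (fun i => S tau n.+1 i w)) /h /=.
  rewrite addrC mulrDr -addrA lerDl -mulrBr mulr_ge0 ?(ltW tau0)//.
  have -> : sg b * k * S tau n.+1 i w - (sg b * k * (y i / n.+1%:R) + k * rho) =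
      k * (sg b * (S tau n.+1 i w - y i / n.+1%:R) - rho) by ring.
  rewrite mulr_ge0 ?(ltW k0)// subr_ge0; apply: ltW; apply: lt_le_trans Hi _.
  rewrite /sg /b; case: ltP => H; last by rewrite expr0 mul1r ger0_norm.
  by rewrite expr1 mulN1r ltr0_norm.
have mf : measurable_fun setT f by exact: measurable_exp_cell.
have /andP[Hf _] := HV tau tau0.
have intle : (\int[P]_w (f w)%:E <=
    (expR (tau * B))%:E * P G + \sum_j \int[P]_w (g j w)%:E)%E.
  rewrite -[P G](_ : \int[P]_w (\1_G w)%:E = _)%E; last first.
    by rewrite (integral_indic P measurableT mG) setIT.
  rewrite -ge0_integralZl//; last first.
    by apply/measurable_EFinP; exact: measurable_indic.
  rewrite -ge0_integral_sum//; [|by move=> j; apply/measurable_EFinP; exact: mg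
                               |by move=> j w _; rewrite lee_fin].
  have u0 w : (0 <= (expR (tau * B))%:E * (\1_G w)%:E)%E.
    by rewrite mule_ge0 ?lee_fin ?expR_ge0// indicE.
  have mu : measurable_fun setT (fun w => (expR (tau * B))%:E * (\1_G w)%:E)%E.
    by apply: emeasurable_funM => //; apply/measurable_EFinP; exact: measurable_indic.
  have v0 w : (0 <= \sum_j (g j w)%:E)%E by apply: sume_ge0 => j _; rewrite lee_fin.
  have mv : measurable_fun setT (fun w => \sum_j (g j w)%:E)%E.
    by apply: emeasurable_sum => j; apply/measurable_EFinP; exact: mg.
  rewrite -ge0_integralD//; apply: ge0_le_integral => //.
  - by move=> w _; rewrite lee_fin expR_ge0.
  - exact/measurable_EFinP.
  - exact: emeasurable_funD.
  - by move=> w _; rewrite sumEFin -EFinM -EFinD lee_fin.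
have gj j : (\int[P]_w (g j w)%:E <=
    (W j * (expR L * expR (- (tau * (n.+1%:R * rho ^+ 2 / 2)))))%:E)%E.
  under eq_integral do rewrite EFinM.
  rewrite ge0_integralZl//; last first.
    by apply/measurable_EFinP; exact: measurable_exp_cell.
  have /andP[_ H] := HW j tau tau0.
  have e0' : (0 <= (expR (- h j))%:E)%E by rewrite lee_fin expR_ge0.
  apply: le_trans (lee_wpmul2l e0' H) _.
  rewrite -EFinM lee_fin mulrCA -/(W j) ler_wpM2l ?(le_trans ler01)//.
  rewrite -!expRD ler_expR.
  have tn : 0 <= tau / n.+1%:R by rewrite divr_ge0 ?ltW.
  have := ler_wpM2l tn (Lam'E j); rewrite mulrDr -/L => HL.
  rewrite addrC -lerBrDr opprK; apply: le_trans HL _.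
  rewrite -addrA lerD2l /h /k le_eqVlt; apply/orP; left; apply/eqP.
  by field; rewrite gt_eqF.
have sumg : (\sum_j \int[P]_w (g j w)%:E <=
    ((\sum_j W j) * (expR L * expR (- (tau * (n.+1%:R * rho ^+ 2 / 2)))))%:E)%E.
  by rewrite mulr_suml -sumEFin; apply: lee_sum => j _.
have small : (\sum_j W j) * expR (- (tau * (n.+1%:R * rho ^+ 2 / 2))) <= V^-1 / 2.
  set x := tau * (n.+1%:R * rho ^+ 2 / 2).
  have xbig : 2 * V * (1 + \sum_j W j) < x.
    move: tau_big; rewrite ltr_pdivrMr// /x.
    by move: (\sum_j W j) (n.+1%:R * rho ^+ 2) => a b; lra.
  have x0 : 0 < x by apply: le_lt_trans xbig; rewrite !mulr_ge0 ?addr_ge0// ltW.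
  have ex : expR (- x) <= x^-1.
    rewrite expRN lef_pV2 ?posrE ?expR_gt0//.
    by apply: le_trans (expR_ge1Dx x); rewrite lerDr.
  apply: (@le_trans _ _ ((\sum_j W j) * x^-1)); first by rewrite ler_wpM2l.
  rewrite ler_pdivrMr// mulrAC ler_pdivlMr// -ler_pdivrMl ?invr_gt0// invrK.
  apply: ltW; apply: le_lt_trans xbig.
  move: W0; move: (\sum_j W j) => a a0.
  have : 0 <= V by exact: ltW.
  by nra.
have PG : P G = (fine (P G))%:E by rewrite fineK// fin_num_measure.
have := le_trans (le_trans Hf intle) (leeD2l _ sumg).
rewrite PG -EFinM -EFinD !lee_fin -/L => main.
have eL : 0 < expR L by exact: expR_gt0.
have H1 : V^-1 / 2 * expR L <= expR (tau * B) * fine (P G).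
  have := ler_wpM2r (ltW eL) small.
  move: main; rewrite -[_ * (expR L * _)]mulrCA -[X in _ + X]mulrC; lra.
rewrite -BA expRD mulrA expRN ler_pdivrMr ?expR_gt0// [leRHS]mulrC.
exact: H1.
Qed.

End tails.

(** * The integral operator *)

Section continuous_functions.
Context {R : realType}.
Local Notation I := (set_type (`[0, 1]%classic : set R)).

Lemma C01_nbhsP (f : C01 R) (V : set (C01 R)) : nbhs f V <->
  exists2 e : R, 0 < e & forall g : C01 R, (forall t, `|f t - g t| < e) -> V g.
Proof.
split.
  move=> /nbhs_ballP[e /= e0 H]; exists e => // g fg; apply: H => t; exact: fg.
by move=> [e e0 H]; apply/nbhs_ballP; exists e => //= g fg; exact: H.
Qed.

Lemma set_val01 (t : I) : `[(0 : R), 1]%classic (\val t).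
Proof. exact: set_valP. Qed.

Lemma near_set_val (t : I) (Q : R -> Prop) :
  (\forall s \near \val t, Q s) -> \forall s \near t, Q (\val s).
Proof. by move=> H; exact: (@initial_continuous _ _ set_val t [set s | Q s] H). Qed.

End continuous_functions.

Section kernel_operator.
Context {R : realType}.
Notation mu := (@lebesgue_measure R).
Local Notation I := (set_type (`[0, 1]%classic : set R)).
Variable K : R -> R -> R.
Hypothesis K_int : forall t : R, `[0, 1]%classic t -> mu.-integrable `[0, 1] (EFin \o K t).
Hypothesis K_mod : forall e t : R, 0 < e -> `[0, 1]%classic t -> \forall s \near t,
  `[0, 1]%classic s -> \int[mu]_(r in `[0, 1]) `|K s r - K t r| <= e.

Definition Kop (phi : R -> R) (t : R) : R := \int[mu]_(r in `[0, 1]) (K t r * phi r).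

Lemma Kop_dist phi s t : unit_ball phi -> `[0, 1]%classic s -> `[0, 1]%classic t ->
  `|Kop phi s - Kop phi t| <= \int[mu]_(r in `[0, 1]) `|K s r - K t r|.
Proof.
move=> B s01 t01.
have di : mu.-integrable `[0, 1] (EFin \o (fun r => K s r - K t r)).
  by apply: (integrableB _ (K_int s01) (K_int t01)).
apply: le_trans (le_RintegralM B di).
rewrite /Kop -RintegralB//; [|exact: (integrableM_unit_ball B (K_int s01))
                            |exact: (integrableM_unit_ball B (K_int t01))].
by under [in leRHS]eq_Rintegral do rewrite mulrBl.
Qed.

Lemma Kop_continuous phi : unit_ball phi -> continuous (fun t : I => Kop phi (\val t)).
Proof.
move=> B t; apply: (proj2 (@cvgrPdist_le _ _ _ _ (nbhs_filter t) _ _)) => e e0.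
have H := near_set_val (K_mod e0 (set_val01 t)).
apply: filterS H => s Hs; rewrite distrC.
exact: le_trans (Kop_dist B (set_val01 _) (set_val01 _)) (Hs (set_val01 s)).
Qed.

Definition Kelt phi (B : unit_ball phi) : C01 R := mkcts (Kop_continuous B).

Lemma KeltE phi (B : unit_ball phi) t : Kelt B t = Kop phi (\val t).
Proof. by []. Qed.

(** At a single [t] this is [cell_int_modulus]. The bound of [Kop_dist], uniform in [phi], extends
    it to a neighbourhood of [t], and compactness of [0,1] gives one [k] for all [t], since
    enlarging [k] only strengthens the premises. *)
Lemma Kop_modulus (e : R) : 0 < e -> exists k, forall n, (k < n)%N ->
  forall phi psi, unit_ball phi -> unit_ball psi ->
  (forall i, (i < n)%N ->
     n%:R * `|cell_int n i phi - cell_int n i psi| <= k.+1%:R^-1) ->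
  forall t, `[0, 1]%classic t -> `|Kop phi t - Kop psi t| <= e.
Proof.
move=> e0.
pose Q (k : nat) (t : R) := forall n, (k < n)%N ->
  forall phi psi, unit_ball phi -> unit_ball psi ->
  (forall i, (i < n)%N ->
     n%:R * `|cell_int n i phi - cell_int n i psi| <= k.+1%:R^-1) ->
  `|Kop phi t - Kop psi t| <= e.
have /compact_near_coveringP/near_covering_withinP := @segment_compact R 0 1.
move=> /(_ nat \oo Q _)[].
  move=> t t01; have e3 : 0 < e / 3 by lra.
  have [k Hk] := cell_int_modulus e3 (K_int t01).
  exists ([set s | `[0, 1]%classic s -> \int[mu]_(r in `[0, 1]) `|K s r - K t r| <= e / 3],
          [set j | (k <= j)%N]) => /=.
    by split; [exact: K_mod|exists k].
  move=> [s j] /= [Hs kj] s01 n jn phi psi B1 B2 H.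
  have := Hk n (leq_ltn_trans kj jn) phi psi B1 B2; rewrite -/(Kop phi t) -/(Kop psi t).
  move=> /(_ _) H1; have {H1} : `|Kop phi t - Kop psi t| <= e / 3.
    apply: H1 => i i_n; apply: le_trans (H i i_n) _.
    by rewrite lef_pV2 ?posrE// ler_nat ltnS.
  have := le_trans (Kop_dist B1 s01 t01) (Hs s01).
  have := le_trans (Kop_dist B2 s01 t01) (Hs s01).
  rewrite !ler_norml => /andP[? ?] /andP[? ?] /andP[? ?]; apply/andP; split; lra.
move=> k _ /(_ k (leqnn k)) Hk; exists k => n kn phi psi B1 B2 H t t01.
by apply: Hk kn _ _ B1 B2 H.
Qed.

(** The cells are half-open so as to be disjoint. At [r = 1] the value is 0, which integrals do not
    see. *)
Definition cell_avg n (phi : R -> R) (r : R) : R :=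
  \sum_(i < n) n%:R * cell_int n i phi * \1_(`[i%:R / n%:R, i.+1%:R / n%:R[%classic) r.

Lemma cell_avgE n phi i r : (i < n)%N ->
  `[i%:R / n%:R, i.+1%:R / n%:R[%classic r -> cell_avg n phi r = n%:R * cell_int n i phi.
Proof.
move=> i_n ri; have n0 : 0 < n%:R :> R by rewrite ltr0n (leq_ltn_trans _ i_n).
rewrite /cell_avg (bigD1 (Ordinal i_n))//= indicE mem_set// mulr1 big1 ?addr0//.
move=> j /negP ji; rewrite indicE memNset ?mulr0// => rj; apply: ji.
apply/eqP/val_inj => /=; move: ri rj; rewrite /= !in_itv/=.
rewrite !ler_pdivrMr// !ltr_pdivlMr// => /andP[a b] /andP[c' d].
apply/eqP; rewrite eqn_leq -ltnS -[X in _ && X]ltnS -(ltr_nat R) -[X in _ && X](ltr_nat R).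
by rewrite (le_lt_trans c' b) (le_lt_trans a d).
Qed.

Lemma cell_avg_ball n phi : unit_ball phi -> unit_ball (cell_avg n phi).
Proof.
move=> B; split.
  by apply: measurable_sum => i; apply: measurable_funM.
move=> r _.
have [[i [i_n ri]]|H] := pselect (exists i, (i < n)%N /\
    `[i%:R / n%:R, i.+1%:R / n%:R[%classic r).
  by rewrite (cell_avgE _ i_n ri) cell_int_norm.
rewrite /cell_avg big1 ?normr0// => i _.
by rewrite indicE memNset ?mulr0// => ri; apply: H; exists i.
Qed.

Lemma mu_cell_half n i : (0 < n)%N ->
  mu (`[i%:R / n%:R, i.+1%:R / n%:R[%classic : set R) = (n%:R^-1)%:E.
Proof.
move=> n0; rewrite lebesgue_measure_itv/= lte_fin ltr_pM2r ?invr_gt0 ?ltr0n//.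
rewrite ltr_nat ltnSn -EFinD -mulrBl.
by rewrite -natrB// subSnn mul1r.
Qed.

(** The general [g] serves twice: [g = id] shows that averaging preserves cell integrals, [g = Lst]
    computes the rate of an average. *)
Lemma cell_int_comp_avg (g : R -> R) n phi i : (i < n)%N ->
  cell_int n i (g \o cell_avg n phi) = g (n%:R * cell_int n i phi) / n%:R.
Proof.
move=> i_n; have n0 : (0 < n)%N by exact: leq_ltn_trans i_n.
set c := g _; rewrite /cell_int -Rintegral_itv_bndo_bndc; last first.
  apply: (@eq_integrable _ _ _ mu _ _ (EFin \o cst c)) => //.
    by move=> r; rewrite inE => ri /=; rewrite (cell_avgE _ i_n ri).
  apply: (@bounded_integrable _ _ _ _ _ _ `|c|) => //.
  apply: sub_mu01_fin => //; apply: subset_trans (@cell_sub R n i i_n).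
  by apply: subset_itvl; rewrite bnd_simp.
rewrite (@eq_Rintegral _ _ _ _ _ (cst c)); last first.
  by move=> r; rewrite inE => ri /=; rewrite (cell_avgE _ i_n ri).
by rewrite Rintegral_cst// [X in fine X](mu_cell_half i n0).
Qed.

Lemma cell_int_avg n phi i : (i < n)%N ->
  cell_int n i (cell_avg n phi) = cell_int n i phi.
Proof.
move=> i_n; have n0 : n%:R != 0 :> R by rewrite pnatr_eq0; case: n i_n.
by rewrite (cell_int_comp_avg id)// mulrC mulKf.
Qed.

Lemma rate_int_avg n phi : (0 < n)%N -> unit_ball phi ->
  rate_int (cell_avg n phi) = n%:R^-1 * \sum_(i < n) Lst (n%:R * cell_int n i phi).
Proof.
move=> n0 B; rewrite /rate_int (cell_intE n0); last first.
  apply: Lst_integrable => //; first by rewrite mu01 ltry.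
  exact: (cell_avg_ball n B).1.
rewrite mulr_sumr; apply: eq_bigr => i _.
by rewrite (cell_int_comp_avg Lst)// mulrC.
Qed.

(** Along the ultrafilter finitely many cell integrals become close at once, and [Kop_modulus] turns
    this into uniform closeness. The ultrafilter refines the filter of late indices, so [n] may be
    taken as large as wanted. *)
Lemma rate_compact (phi_ : nat -> R -> R) (c : R) :
  (forall n, unit_ball (phi_ n)) -> (forall n, rate_int (phi_ n) <= c) ->
  exists phi, [/\ unit_ball phi, rate_int phi <= c &
    forall e k, 0 < e -> exists n, (k <= n)%N /\
      forall t, `[0, 1]%classic t -> `|Kop (phi_ n) t - Kop phi t| <= e].
Proof.
move=> B Jc; have [U [UU ooU]] := ultraFilterLemma (@eventually_filter).
have [phi Bphi Hphi] := weak_limit UU B.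
exists phi; split => //; first exact: (@rate_int_lsc _ U UU phi_ phi B Bphi Hphi c Jc).
move=> e k e0; have [m Hm] := Kop_modulus e0.
have near_cell i : (i < m.+1)%N -> \forall n \near U,
    m.+1%:R * `|cell_int m.+1 i (phi_ n) - cell_int m.+1 i phi| <= m.+1%:R^-1.
  move=> im; have m0 : 0 < m.+1%:R^-1 / m.+1%:R :> R by rewrite divr_gt0.
  have := Hphi _ (measurable_itv _) (@cell_sub R m.+1 i im).
  move/cvgrPdist_le => /(_ _ m0); apply: filterS => n.
  by rewrite distrC ler_pdivlMr// mulrC.
have near_all : \forall n \near U, forall i : 'I_m.+1,
    m.+1%:R * `|cell_int m.+1 i (phi_ n) - cell_int m.+1 i phi| <= m.+1%:R^-1.
  by apply: filter_forall => i; exact: near_cell.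
have near_k : \forall n \near U, (k <= n)%N by apply: ooU; exists k.
have [n [n1 n2]] := @filter_ex _ U _ _ (filterI near_all near_k).
exists n; split => //; apply: (Hm m.+1) => // i im.
exact: (n1 (Ordinal im)).
Qed.

Lemma integral_Lambda_star phi : unit_ball phi ->
  (\int[mu]_(r in `[0%R, 1%R]) Lambda_star (phi r) = (rate_int phi)%:E)%E.
Proof.
move=> B; rewrite /rate_int /Rintegral fineK; last first.
  apply: integrable_fin_num => //; apply: Lst_integrable => //; last exact: B.1.
  by rewrite mu01 ltry.
by apply: eq_integral => r; rewrite inE => r01; rewrite /Lambda_star (B.2 r r01).
Qed.

Lemma measurable_Lambda_star : measurable_fun setT (@Lambda_star R).
Proof.
apply: measurable_fun_ifT => //.
- by apply: measurable_fun_ler => //; exact: measurableT_comp.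
- by apply/measurable_EFinP; exact: measurable_Lst.
Qed.

Lemma rate_I_ge0 f : (0 <= rate_I K f)%E.
Proof.
apply: le_ereal_inf_tmp => _ [phi _ <-]; apply: integral_ge0 => r _.
rewrite /Lambda_star; case: ifP => // _.
by rewrite lee_fin; exact: Lst_ge0.
Qed.

Lemma unit_ball_L2 (phi : R -> R) : unit_ball phi -> L2_01 phi.
Proof.
move=> B; split; first exact: B.1.
apply: (@le_lt_trans _ _ (\int[mu]_(r in `[0%R, 1%R]) (1 : R)%:E)%E); last first.
  by rewrite integral_cst//= mu01 mule1 ltry.
apply: ge0_le_integral => //.
- by move=> r _; rewrite lee_fin sqr_ge0.
- by apply/measurable_EFinP; apply: measurable_funX; exact: B.1.
- move=> r r01; rewrite lee_fin -[leRHS](expr1n _ 2) -real_normK ?num_real//.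
  by rewrite lerXn2r ?nnegrE//; exact: B.2.
Qed.

Lemma rate_I_le phi (B : unit_ball phi) : (rate_I K (Kelt B) <= (rate_int phi)%:E)%E.
Proof.
apply: ereal_inf_lbound; exists phi; last exact: integral_Lambda_star.
by split; [exact: unit_ball_L2|].
Qed.

(** [Lambda_star] is infinite off [-1, 1], so a finite integral forces |psi| <= 1 almost everywhere
    on [0,1], and truncating [psi] changes neither the rate nor the image. This confines the
    variational problem to the unit ball. *)
Lemma rate_I_lt f (c : R) : (rate_I K f < c%:E)%E ->
  exists phi, exists B : unit_ball phi, f = Kelt B /\ rate_int phi < c.
Proof.
move=> /ereal_inf_lt[_ [psi [[mpsi _] fpsi] <-]] Jc.
pose phi r := Num.max (-1) (Num.min 1 (psi r)).
have mphi : measurable_fun (`[0, 1] : set R) phi.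
  by apply: measurable_maxr => //; exact: measurable_minr.
have phi1 r : `|phi r| <= 1.
  rewrite ler_norml /phi le_max lexx/= ge_max ge_min lexx/= andbT; lra.
have B : unit_ball phi by split.
have mL (g : R -> R) : measurable_fun (`[0, 1] : set R) g ->
    measurable_fun (`[0, 1] : set R) (fun r => Lambda_star (g r)).
  by move=> mg; apply: (measurableT_comp measurable_Lambda_star mg).
have L0 (x : R) : (0 <= Lambda_star x)%E.
  rewrite /Lambda_star; case: ifP => // _.
  by rewrite lee_fin; exact: Lst_ge0.
have Li : mu.-integrable `[0, 1] (fun r => Lambda_star (psi r)).
  apply/integrableP; split; first exact: mL.
  under eq_integral do rewrite gee0_abs//.
  exact: lt_trans Jc (ltry _).
have psiphi : {ae mu, forall r, `[0, 1]%classic r -> psi r = phi r}.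
  have m01 : measurable (`[0, 1]%classic : set (measurableTypeR R)) by exact: measurable_itv.
  have := integrable_ae m01 Li; apply: filterS => r Hr r01.
  have := Hr r01; rewrite /Lambda_star; case: ifP => // + _.
  rewrite ler_norml => /andP[p1 p2]; rewrite /phi min_r// max_r//.
exists phi, B; split.
  apply/continuousEP => t; rewrite fpsi KeltE /Kop /Rintegral; congr fine.
  have [mK _] := integrableP _ _ _ (K_int (set_val01 t)).
  have {}mK : measurable_fun (`[0, 1] : set R) (K (\val t)) by exact/measurable_EFinP.
  apply: ae_eq_integral => //.
  - by apply/measurable_EFinP; exact: measurable_funM.
  - by apply/measurable_EFinP; exact: measurable_funM.
  - by apply: (filterS (F := almost_everywhere mu)) psiphi => r Hr r01; rewrite Hr.
rewrite -lte_fin -integral_Lambda_star//; apply: le_lt_trans Jc.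
rewrite le_eqVlt; apply/orP; left; apply/eqP/ae_eq_integral => //; try exact: mL.
by apply: (filterS (F := almost_everywhere mu)) psiphi => r Hr r01; rewrite Hr.
Qed.

Lemma rate_I_lsc : lower_semicontinuous (rate_I K).
Proof.
move=> f a aI; apply: contrapT => H.
(* Points near [f] would have rate at most [a], and [rate_I_lt] asks for a strict bound; [b]
   provides it while staying below the rate of [f]. *)
have [b ab bI] : exists2 b : R, a < b & (b%:E < rate_I K f)%E.
  move: aI; case: (rate_I K f) => [r| |]//; last by exists (a + 1); rewrite ?ltry ?ltrDl.
  by rewrite lte_fin => ar; exists ((a + r) / 2); rewrite ?lte_fin; lra.
have Hn (n : nat) : exists phi, exists B : unit_ball phi,
    (forall t, `|f t - Kelt B t| < n.+1%:R^-1) /\ rate_int phi <= b.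
  apply: contrapT => Hn; apply: H.
  exists [set g : C01 R | forall t, `|f t - g t| < n.+1%:R^-1].
    by apply/C01_nbhsP; exists n.+1%:R^-1.
  move=> g fg; rewrite ltNge; apply/negP => ga; apply: Hn.
  have [|phi [B [gE Jb]]] := @rate_I_lt g b.
    by apply: le_lt_trans ga _; rewrite lte_fin.
  by exists phi, B; rewrite -gE; split => //; exact: ltW.
have [phi_ Hphi] := choice Hn.
have B n : unit_ball (phi_ n) by have [B _] := Hphi n.
have [phi [Bphi Jphi near_phi]] := rate_compact B
  (fun n => let: ex_intro _ H := Hphi n in H.2).
suff fE : f = Kelt Bphi.
  have : (rate_I K f <= b%:E)%E by rewrite fE (le_trans (rate_I_le Bphi)).
  by rewrite leNgt bI.
apply/continuousEP => t; apply/eqP; rewrite KeltE -subr_eq0 -normr_le0.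
apply/ler_addgt0Pr => e e0; rewrite add0r.
have e2 : 0 < e / 2 by lra.
have [n [kn Hn2]] := near_phi _ (Num.truncn (e / 2)^-1) e2.
have [B' [fn _]] := Hphi n.
have ne : n.+1%:R^-1 < e / 2.
  rewrite invf_plt ?posrE//; apply: lt_le_trans (truncnS_gt _) _.
  by rewrite ler_nat ltnS.
have := fn t; rewrite KeltE => H1; have H2 := Hn2 _ (set_val01 t).
rewrite (splitr e) (le_trans (ler_distD (Kop (phi_ n) (\val t)) _ _))// lerD//.
exact: ltW (lt_trans H1 ne).
Qed.

(** Otherwise, for each [n], some [phi_ n] has its image in [F] while its cell averages have rate at
    most [c]. A weak limit of the averages has rate at most [c], and its image is approached by
    those of the [phi_ n], because averaging preserves cell integrals; it thus lies in [F], a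
    contradiction. This fixes the number of cells before [eps] varies. *)
Lemma closed_rate_cells (F : set (C01 R)) (c : R) : closed F ->
  (forall f, F f -> (c%:E < rate_I K f)%E) -> exists n,
  forall phi (B : unit_ball phi), F (Kelt B) ->
    c <= n.+1%:R^-1 * \sum_(i < n.+1) Lst (n.+1%:R * cell_int n.+1 i phi).
Proof.
move=> clF cI; apply: contrapT => H.
have Hn (n : nat) : exists phi, exists B : unit_ball phi,
    F (Kelt B) /\ rate_int (cell_avg n.+1 phi) <= c.
  apply: contrapT => Hn; apply: H; exists n => phi B FB.
  rewrite leNgt; apply/negP => lt_c; apply: Hn; exists phi, B; split => //.
  by rewrite rate_int_avg// ltW.
have [phi_ Hphi] := choice Hn.
have B n : unit_ball (phi_ n) by have [B _] := Hphi n.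
have Bpsi n := cell_avg_ball n.+1 (B n).
have [|psi [Bp Jp near_psi]] := @rate_compact (fun n => cell_avg n.+1 (phi_ n)) c Bpsi.
  by move=> n; have [B' [_ Jn]] := Hphi n.
suff /cI : F (Kelt Bp).
  by rewrite ltNge (le_trans (rate_I_le Bp)).
apply: clF => V /C01_nbhsP[e e0 HV].
have e3 : 0 < e / 3 by lra.
have [k Hk] := Kop_modulus e3.
have [n [kn Hn2]] := near_psi _ k e3.
have [B' [FB' _]] := Hphi n.
exists (Kelt B'); split => //; apply: HV => t; rewrite !KeltE.
have H1 : `|Kop (phi_ n) (\val t) - Kop (cell_avg n.+1 (phi_ n)) (\val t)| <= e / 3.
  apply: (Hk n.+1) => //; last exact: set_val01.
  by move=> i i_n; rewrite cell_int_avg// subrr normr0 mulr0 invr_ge0.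
have H2 := Hn2 _ (set_val01 t).
rewrite distrC; apply: le_lt_trans (ler_distD (Kop (cell_avg n.+1 (phi_ n)) (\val t)) _ _) _.
by apply: le_lt_trans (lerD H1 H2) _; lra.
Qed.

End kernel_operator.

(** * Transfer to C([0,1]) *)

Section large_deviations.
Context {R : realType} {d : measure_display} {T : measurableType d}.
Variables (P : probability T R) (N : R -> T -> nat).
Hypothesis HN : standard_poisson_process P N.
Notation mu := (@lebesgue_measure R).
Variable K : R -> R -> R.
Hypothesis K_int : forall t : R, `[0, 1]%classic t -> mu.-integrable `[0, 1] (EFin \o K t).
Hypothesis K_mod : forall e t : R, 0 < e -> `[0, 1]%classic t -> \forall s \near t,
  `[0, 1]%classic s -> \int[mu]_(r in `[0, 1]) `|K s r - K t r| <= e.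

Let inv_sqr_gt0 (eps : R) : 0 < eps -> 0 < eps ^- 2.
Proof. by move=> e0; rewrite invr_gt0 exprn_gt0. Qed.

Lemma unit_ball_cst0 : unit_ball (fun _ : R => 0 : R).
Proof. by split => // r _; rewrite normr0 ler01. Qed.

(** The proof of [0 < eps] is an ingredient of the path, hence the case analysis; for [eps <= 0] the
    zero function is a junk value that limits at [0^'+] never see. *)
Definition scaled_process (eps : R) (w : T) : C01 R :=
  match pselect (0 < eps) with
  | left e0 => Kelt K_int K_mod (telegraph_ball HN w (inv_sqr_gt0 e0))
  | right _ => Kelt K_int K_mod unit_ball_cst0
  end.

Lemma scaled_processE eps w : 0 < eps -> exists B : unit_ball (telegraph N (eps ^- 2) w),
  scaled_process eps w = Kelt K_int K_mod B.
Proof.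
by move=> e0; rewrite /scaled_process; case: pselect => // e0'; eexists; reflexivity.
Qed.

Lemma scaled_process_spec eps : 0 < eps ->
  forall w (t : set_type (`[0, 1]%classic : set R)),
  scaled_process eps w t = eps * G_process K N eps (\val t) w.
Proof.
move=> e0 w t; have [B ->] := scaled_processE w e0.
have KB := integrableM_unit_ball B (K_int (set_val01 t)).
rewrite KeltE /Kop /G_process /theta.
have -> : \int[mu]_(r in `[0, 1]) (K (\val t) r * (eps^-1 * (-1) ^+ N (eps ^- 2 * r) w)) =
    \int[mu]_(r in `[0, 1]) (eps^-1 * (K (\val t) r * telegraph N (eps ^- 2) w r)).
  by apply: eq_Rintegral => r _; rewrite mulrCA.
by rewrite RintegralZl// mulrA divff ?mul1r// gt_eqF.
Qed.

Lemma scaled_process_modulus (e : R) : 0 < e -> exists k, forall n, (k < n)%N ->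
  forall eps w phi (B : unit_ball phi), 0 < eps ->
  (forall i, (i < n)%N ->
     n%:R * `|cell_int n i (telegraph N (eps ^- 2) w) - cell_int n i phi| <= k.+1%:R^-1) ->
  forall t, `|scaled_process eps w t - Kelt K_int K_mod B t| <= e.
Proof.
move=> e0; have [k Hk] := Kop_modulus K_int K_mod e0.
exists k => n kn eps w phi B eps0 H t.
have [B' ->] := scaled_processE w eps0.
exact: (Hk n kn _ _ B' B H _ (set_val01 t)).
Qed.

Lemma measurable_scaled_process eps (A : set (C01 R)) : 0 < eps -> borel A ->
  measurable (scaled_process eps @^-1` A).
Proof.
move=> e0 bA.
(* For each [m] the trajectory is known up to [1 / m.+1] from the integer parts
   of finitely many rescaled cell integrals, which makes the preimage of an open
   set a countable union of measurable events. *)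
have openP (O : set (C01 R)) : open O -> measurable (scaled_process eps @^-1` O).
  move=> oO.
  have tau0 := inv_sqr_gt0 e0.
  pose k (m : nat) : nat := sval (cid (scaled_process_modulus (divr_gt0 (@ltr01 R) (ltr0Sn R m)))).
  have Hk m := svalP (cid (scaled_process_modulus (divr_gt0 (@ltr01 R) (ltr0Sn R m)))).
  pose n m := (k m).+1.
  pose S m i w := cell_int (n m) i (telegraph N (eps ^- 2) w).
  (* Equal integer parts in units of [r m] make two cell integrals differ by at most
     [(n m)^-1 * (n m)^-1]; multiplied by [n m], this is exactly the tolerance [(k m).+1^-1]. *)
  pose r m : R := (n m)%:R^-1 * (n m)%:R^-1.
  have r0 m : 0 < r m by rewrite mulr_gt0 ?invr_gt0.
  pose cell m (z : {ffun 'I_(n m) -> int}) : set T :=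
    [set w | forall i : 'I_(n m), Num.floor (S m i w / r m) = z i].
  have mcell m z : measurable (cell m z).
    rewrite (_ : cell m z = \bigcap_(i : 'I_(n m))
        ((fun w => S m i w / r m) @^-1` `[(z i)%:~R, (z i + 1)%:~R[)); last first.
      apply/seteqP; split => [w wz i _ /=|w wz i].
        by rewrite in_itv/= -(wz i) floor_itv.
      by apply: floor_def; have := wz i I; rewrite /= in_itv/=.
    apply: fin_bigcap_measurable => // i _; rewrite -[X in measurable X]setTI.
    suff : measurable_fun setT (fun w => S m i w / r m).
      by apply => //; exact: measurable_itv.
    by apply: measurable_funM => //; exact: (measurable_cell_int HN).
  have -> : scaled_process eps @^-1` O = \bigcup_(p in
      [set p : {m : nat & {ffun 'I_(n m) -> int}} |
         cell (tag p) (tagged p) `<=` scaled_process eps @^-1` O])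
      cell (tag p) (tagged p).
    apply/seteqP; split => [w Ow|w [p pO wp]]; last exact: pO.
    have /C01_nbhsP[e e_gt0 He] : nbhs (scaled_process eps w) O by exact: open_nbhs_nbhs.
    pose m := Num.truncn e^-1.
    have me : 1 / m.+1%:R < e.
      by rewrite div1r invf_plt ?posrE//; exact: truncnS_gt.
    exists (Tagged (fun m => {ffun 'I_(n m) -> int})
              [ffun i : 'I_(n m) => Num.floor (S m i w / r m)]); last first.
      by move=> i /=; rewrite ffunE.
    move=> w' /= ww'; apply: He => t; apply: le_lt_trans me.
    have [B EB] := scaled_processE w' e0; rewrite EB.
    apply: (Hk m (n m) (ltnSn _)) => // i i_n.
    have := ww' (Ordinal i_n); rewrite ffunE /= => fl.
    rewrite -/(S m i w) -/(S m i w').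
    have n0 : 0 < (n m)%:R :> R by rewrite ltr0n.
    have d1 : `|S m i w / r m - S m i w' / r m| <= 1.
      have /andP[a1 a2] := floor_itv (S m i w / r m).
      have /andP[b1 b2] := floor_itv (S m i w' / r m).
      rewrite fl in b1 b2; rewrite intrD in a2 b2.
      by rewrite ler_norml; apply/andP; split; lra.
    rewrite -mulrBl normrM normfV (gtr0_norm (r0 m)) ler_pdivrMr// mul1r in d1.
    by rewrite -ler_pdivlMl// -/(n m).
  rewrite bigcup_mkcond; apply: countable_bigcupT_measurable => [|p].
    exact: countableP.
  by case: ifP.
have : @borel (C01 R) `<=` [set B | measurable (scaled_process eps @^-1` B)].
  apply: smallest_sub => //; split => /=.
  - by rewrite preimage_set0.
  - by move=> B mB; rewrite setTD preimage_setC; exact: measurableC.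
  - by move=> F mF; rewrite preimage_bigcup; exact: bigcupT_measurable.
exact.
Qed.

Let scaled_log (A : set (C01 R)) (eps : R) : \bar R :=
  ((eps ^+ 2)%:E * lne (P (scaled_process eps @^-1` A)))%E.

Lemma limf_einf_le_esup (f : R -> \bar R) (F : set_system R) : ProperFilter F ->
  (limf_einf f F <= limf_esup f F)%E.
Proof.
move=> FF; rewrite limf_einfE limf_esupE.
apply: ge_ereal_sup => _ [V FV <-]; apply: le_ereal_inf_tmp => _ [W FW <-].
have [x [Vx Wx]] := @filter_ex _ F _ _ (filterI FV FW).
apply: (@le_trans _ _ (f x)).
  by apply: ereal_inf_lbound; exists x.
by apply: ereal_sup_ubound; exists x.
Qed.

Lemma lee_from_below (x y : \bar R) :
  (forall c : R, (c%:E < x)%E -> (c%:E <= y)%E) -> (x <= y)%E.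
Proof.
case: x => [r| |] H; last by rewrite leNye.
- case: y H => [s| |] H; rewrite ?leey//.
    rewrite leNgt; apply/negP; rewrite lte_fin => sr.
    have := H ((s + r) / 2); rewrite lte_fin lee_fin => /(_ _); lra.
  by have := H (r - 1); rewrite lte_fin gtrBl ltr01 => /(_ isT).
- case: y H => [s| |] H//.
    by have := H (s + 1) (ltry _); rewrite lee_fin gerDl ler10.
  by have := H 0 (ltry _).
Qed.

Lemma lee_from_above (x y : \bar R) :
  (forall c : R, (x < c%:E)%E -> (y <= c%:E)%E) -> (y <= x)%E.
Proof.
move=> H; rewrite -leeN2; apply: lee_from_below => c cx.
rewrite leeNr -EFinN; apply: H.
by rewrite EFinN lteNr.
Qed.

Lemma near0_sqr_le (a e : R) : 0 < e -> \forall eps \near 0^'+, eps ^+ 2 * a <= e.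
Proof.
move=> e0; near=> eps.
have eps0 : 0 < eps by near: eps; exact: nbhs_right_gt.
have eps1 : eps < 1 by near: eps; exact: nbhs_right_lt.
have epsa : eps < e / (`|a| + 1).
  by near: eps; apply: nbhs_right_lt; rewrite divr_gt0// ltr_wpDl.
rewrite ltr_pdivlMr ?ltr_wpDl// in epsa.
have aa := ler_norm a; have a0 := normr_ge0 a.
have : eps ^+ 2 * a <= eps ^+ 2 * `|a| by rewrite ler_wpM2l// sqr_ge0.
have : eps ^+ 2 * `|a| <= eps * `|a| by rewrite ler_wpM2r// expr2 ler_piMr// ltW.
lra.
Unshelve. all: by end_near. Qed.

Lemma near0_inv_sqr (Q : R -> Prop) : (\forall tau \near +oo, Q tau) ->
  \forall eps \near 0^'+, Q (eps ^- 2).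
Proof.
move=> [M [_ HM]]; near=> eps; apply: HM.
have eps0 : 0 < eps by near: eps; exact: nbhs_right_gt.
have eps1 : eps < 1 by near: eps; exact: nbhs_right_lt.
have epsM : eps < (`|M| + 1)^-1.
  by near: eps; apply: nbhs_right_lt; rewrite invr_gt0 ltr_wpDl.
have M1 : 0 < `|M| + 1 by rewrite ltr_wpDl.
have : eps ^+ 2 < (`|M| + 1)^-1.
  by apply: le_lt_trans epsM; rewrite expr2 ler_piMr// ltW.
rewrite -ltf_pV2 ?posrE ?invr_gt0 ?exprn_gt0// invrK; apply: le_lt_trans.
by apply: le_trans (ler_norm M) _; rewrite lerDl.
Unshelve. all: by end_near. Qed.

Lemma limf_esup_le (f : R -> \bar R) (F : set_system R) (c : \bar R) :
  (\forall x \near F, (f x <= c)%E) -> (limf_esup f F <= c)%E.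
Proof.
move=> H; rewrite limf_esupE; apply: ge_ereal_inf.
exists (ereal_sup (f @` [set x | (f x <= c)%E])); first by exists [set x | (f x <= c)%E].
by apply: ge_ereal_sup => _ [x fx <-].
Qed.

Lemma limf_einf_ge (f : R -> \bar R) (F : set_system R) (c : \bar R) :
  (\forall x \near F, (c <= f x)%E) -> (c <= limf_einf f F)%E.
Proof.
move=> H; rewrite limf_einfE; apply: le_ereal_sup_tmp.
exists (ereal_inf (f @` [set x | (c <= f x)%E])); first by exists [set x | (c <= f x)%E].
by apply: le_ereal_inf_tmp => _ [x fx <-].
Qed.

(** The infimum may be infinite, so the bound is shown for every real [c] below it.
    [closed_rate_cells] then yields one [n] for which the event is contained in that of
    [upper_tail], whose constant vanishes at scale [eps ^+ 2]. *)
Lemma ldp_upper_bound (A : set (C01 R)) : borel A ->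
  (limf_esup (scaled_log A) 0^'+ <= - ereal_inf (rate_I K @` closure A))%E.
Proof.
move=> bA; rewrite leeNr; apply: lee_from_below => c cI; rewrite leeNr -EFinN.
have [||n Hn] := @closed_rate_cells R K K_int K_mod (closure A) c.
- exact: closed_closure.
- move=> f Af; apply: lt_le_trans cI _.
  by apply: ereal_inf_lbound; exists f.
apply/lee_addgt0Pr => e e0.
have e2 : 0 < e / 2 by lra.
have [C C0 HC] := upper_tail HN n c e2.
apply: limf_esup_le; near=> eps.
have eps0 : 0 < eps by near: eps; exact: nbhs_right_gt.
have epsC : eps ^+ 2 * ln C <= e / 2 by near: eps; exact: near0_sqr_le.
have tau0 := inv_sqr_gt0 eps0.
have Ple := HC _ tau0.
set D := [set w | _] in Ple.
have AD : scaled_process eps @^-1` A `<=` D.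
  move=> w; rewrite /= /D /=; have [B ->] := scaled_processE w eps0.
  by move=> /subset_closure; exact: Hn.
have mD : measurable D by exact: (measurable_cell_rate HN).
have PA : (P (scaled_process eps @^-1` A) <= (C * expR (- (eps ^- 2 * (c - e / 2))))%:E)%E.
  apply: le_trans Ple; apply: le_measure => //; rewrite inE //.
  exact: measurable_scaled_process.
have C1 : 0 < C * expR (- (eps ^- 2 * (c - e / 2))) by rewrite mulr_gt0// expR_gt0.
rewrite /scaled_log.
apply: (@le_trans _ _ ((eps ^+ 2)%:E * lne (C * expR (- (eps ^- 2 * (c - e / 2))))%:E)%E).
  apply: lee_wpmul2l; first by rewrite lee_fin sqr_ge0.
  by rewrite lee_lne// in_itv/= ?measure_ge0 ?leey// lee_fin ltW.
rewrite lne_EFin// lnM ?posrE ?expR_gt0// expRK -EFinM -EFinD lee_fin.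
rewrite mulrDr mulrN mulrA divff ?mul1r; last by rewrite gt_eqF// exprn_gt0.
lra.
Unshelve. all: by end_near. Qed.

Lemma ldp_lower_bound (A : set (C01 R)) : borel A ->
  (- ereal_inf (rate_I K @` A°) <= limf_einf (scaled_log A) 0^'+)%E.
Proof.
move=> bA; rewrite leeNl; apply: le_ereal_inf_tmp => _ [f Af <-].
apply: lee_from_above => c Ic; rewrite leeNl -EFinN.
have [phi [B [fE Jc]]] := rate_I_lt K_int K_mod Ic.
have /C01_nbhsP[e e0 He] : nbhs f A := Af.
have e2 : 0 < e / 2 by lra.
have [k Hk] := scaled_process_modulus e2.
have n0 : 0 < k.+1%:R :> R by rewrite ltr0n.
(* Half of the tolerance [k.+1%:R^-1] goes to the shrinking of [y], half to the radius [rho] of the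
   box. *)
pose dl : R := (2 * k.+1%:R)^-1.
have dl0 : 0 < dl by rewrite invr_gt0 mulr_gt0.
have dl1 : dl <= 1 / 2.
  by rewrite div1r lef_pV2 ?posrE ?mulr_gt0// ler_peMr// ler1n.
pose s i := cell_int k.+1 i phi.
(* Shrinking by [1 - dl] keeps the optimal tilts finite where [|phi| = 1]. *)
pose y i := (1 - dl) * (k.+1%:R * s i).
have s1 i : (i < k.+1)%N -> `|k.+1%:R * s i| <= 1 by exact: cell_int_norm.
have y1 i : (i < k.+1)%N -> `|y i| < 1.
  move=> ik; rewrite /y normrM ger0_norm; last lra.
  have := s1 i ik; have := normr_ge0 (k.+1%:R * s i).
  by move: `|k.+1%:R * s i| => z; nra.
(* Jensen's inequality, cell by cell: the supporting line of [Lst] at [y i], given by [Lam_young]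
   with the tilt [slope (y i)], is integrated along [(1 - dl) * phi], and [ler_Lst] removes the
   factor [1 - dl]. *)
have Jy : k.+1%:R^-1 * \sum_(i < k.+1) Lst (y i) <= rate_int phi.
  have Li : mu.-integrable `[0, 1] (EFin \o (fun r => Lst (phi r))).
    by apply: Lst_integrable => //; [rewrite mu01 ltry|exact: B.1].
  rewrite /rate_int (cell_intE (ltn0Sn k) Li) mulr_sumr ler_sum// => i _.
  rewrite -(Lam_dual (y1 i (ltn_ord i))).
  have sub := @cell_sub R k.+1 i (ltn_ord i).
  have mc : measurable (`[i%:R / k.+1%:R, i.+1%:R / k.+1%:R]%classic :
    set (measurableTypeR R)) by exact: measurable_itv.
  have c1 := sub_mu01_fin mc sub.
  have m01 : measurable (`[0, 1]%classic : set (measurableTypeR R)) by exact: measurable_itv.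
  have pi := unit_ball_integrable B mc sub.
  have [ai aE] := Rintegral_affine (slope (y i) * (1 - dl)) (Lam (slope (y i))) mc c1 pi.
  have muc : fine (mu (`[i%:R / k.+1%:R, i.+1%:R / k.+1%:R]%classic : set R)) = k.+1%:R^-1.
    by rewrite mu_cell.
  have -> : k.+1%:R^-1 * (slope (y i) * y i - Lam (slope (y i))) =
      slope (y i) * (1 - dl) * s i - Lam (slope (y i)) * k.+1%:R^-1.
    rewrite {2}/y mulrBr; congr (_ - _); last by rewrite mulrC.
    rewrite [(1 - dl) * _]mulrCA [slope (y i) * (_ * _)]mulrCA.
    by rewrite mulKf ?lt0r_neq0// mulrA.
  rewrite -muc -aE; apply: le_Rintegral => //.
    exact: (integrableS m01 mc sub Li).
  move=> r /sub r01; rewrite -mulrA.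
  have p1 := B.2 r r01; have q1 : `|(1 - dl) * phi r| <= `|phi r|.
    rewrite normrM ger0_norm; last by rewrite subr_ge0; lra.
    by rewrite ler_piMl// gerBl ltW.
  apply: le_trans (Lam_young _ (le_trans q1 p1)) _.
  exact: ler_Lst.
set J := rate_int phi in Jc Jy.
pose W : R := \sum_(i < k.+1) `|slope (y i)|.
have W0 : 0 <= W by rewrite sumr_ge0.
(* The first bound keeps the box inside the neighbourhood of [f]; the second keeps the excess
   [rho * W] within half of the slack [c - J], whose other half absorbs [eps ^+ 2 * - ln c0]. *)
pose rho : R := Num.min (dl / k.+1%:R) ((c - J) / 2 / (W + 1)).
have rho0 : 0 < rho.
  by rewrite lt_min !divr_gt0 ?subr_gt0// ltr_wpDl.
have [c0 c00 Hc0] := lower_tail HN rho0 y1.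
have rW : rho * W <= (c - J) / 2.
  have r2 : rho <= (c - J) / 2 / (W + 1) by rewrite ge_min lexx orbT.
  rewrite ler_pdivlMr ?ltr_wpDl// in r2.
  by apply: le_trans r2; rewrite mulrDr mulr1 lerDl ltW.
have cJ : k.+1%:R^-1 * (\sum_(i < k.+1) Lst (y i)) + rho * W <= J + (c - J) / 2.
  exact: lerD.
have cJ2 : 0 < (c - J) / 2 by lra.
apply: limf_einf_ge; near=> eps.
have eps0 : 0 < eps by near: eps; exact: nbhs_right_gt.
have epsc : eps ^+ 2 * - ln c0 <= (c - J) / 2 by near: eps; exact: near0_sqr_le.
have Pge : (((c0 * expR (- (eps ^- 2 * (k.+1%:R^-1 * \sum_(i < k.+1) Lst (y i)
       + rho * \sum_(i < k.+1) `|slope (y i)|))))%:E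
   <= P [set w | forall i, (i < k.+1)%N ->
          (`|cell_int k.+1 i (telegraph N (eps ^- 2) w) - y i / k.+1%:R| <= rho)%R])%E).
  by near: eps; exact: near0_inv_sqr Hc0.
rewrite -/W in Pge; set D := [set w | _] in Pge.
have DA : D `<=` scaled_process eps @^-1` A.
  move=> w Dw; apply: He => t; rewrite fE distrC.
  apply: (@le_lt_trans _ _ (e / 2)); last lra.
  apply: (Hk k.+1) => // i ik.
  have yE : y i / k.+1%:R = (1 - dl) * s i.
    by rewrite /y [k.+1%:R * _]mulrC mulrA mulfK// lt0r_neq0.
  have := Dw i ik; rewrite yE => Di.
  have rd : rho * k.+1%:R <= dl.
    by rewrite -ler_pdivlMr// ge_min lexx.
  have dd : dl + dl = k.+1%:R^-1.
    by rewrite -[LHS]mulr2n -[LHS]mulr_natl /dl invfM mulrA mulfV ?mul1r// pnatr_eq0.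
  have tri : `|cell_int k.+1 i (telegraph N (eps ^- 2) w) - s i| <= rho + dl * `|s i|.
    rewrite -[X in _ + X * _](gtr0_norm dl0) -normrM; apply: le_trans (lerD Di (lexx _)).
    rewrite -[dl * _]opprK normrN; apply: le_trans (ler_normD _ _).
    by rewrite le_eqVlt; apply/orP; left; apply/eqP; congr `|_|; ring.
  rewrite -/(s i) -dd; apply: (@le_trans _ _ (k.+1%:R * (rho + dl * `|s i|))).
    by rewrite ler_pM2l.
  have := s1 i ik; rewrite normrM gtr0_norm// => si.
  have : dl * (k.+1%:R * `|s i|) <= dl by rewrite ler_piMr// ltW.
  by rewrite mulrDr mulrC [k.+1%:R * (_ * _)]mulrCA; lra.
have PA : (P D <= P (scaled_process eps @^-1` A))%E.
  apply: le_measure => //; rewrite inE; last exact: measurable_scaled_process.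
  exact: (measurable_cell_box HN k.+1 (fun i => y i / k.+1%:R) rho (inv_sqr_gt0 eps0)).
set a := k.+1%:R^-1 * _ + _ in Pge.
have C1 : 0 < c0 * expR (- (eps ^- 2 * a)) by rewrite mulr_gt0// expR_gt0.
rewrite /scaled_log.
apply: (@le_trans _ _ ((eps ^+ 2)%:E * lne (c0 * expR (- (eps ^- 2 * a)))%:E)%E).
  rewrite lne_EFin// lnM ?posrE ?expR_gt0// expRK -EFinM lee_fin.
  rewrite mulrDr mulrN mulrA divff ?mul1r; last by rewrite gt_eqF// exprn_gt0.
  by rewrite mulrN in epsc; rewrite -/a in cJ; lra.
apply: lee_wpmul2l; first by rewrite lee_fin sqr_ge0.
rewrite lee_lne ?(le_trans Pge)// in_itv/= ?measure_ge0 ?leey// lee_fin ltW//.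
Unshelve. all: by end_near. Qed.

End large_deviations.

(** * Continuity of the kernel in L^1 *)

Section kernel_increments.
Context {R : realType}.
Notation mu := (@lebesgue_measure R).
Variable K : R -> R -> R.
Hypothesis K_measurable : measurable_fun ((`[0, 1] : set R) `*` (`[0, 1] : set R))
  (fun p : R * R => K p.1 p.2).
Hypothesis K_zero : forall r : R, r \in `[0, 1] -> K 0 r = 0.
Variables (calG : R -> R) (alpha : R).
Hypothesis calG_increasing : {in `[0, 1] &, {homo calG : s t / s < t}}.
Hypothesis calG_continuous : {within `[0, 1], continuous calG}.
Hypothesis alpha_gt0 : 0 < alpha.
Hypothesis K_increments : forall s t : R, 0 <= s -> s < t -> t <= 1 ->
  (\int[lebesgue_measure]_(r in `[0%R, 1%R]) ((K t r - K s r) ^+ 2)%:E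
     <= ((calG t - calG s) `^ alpha)%:E)%E.

Lemma measurable_kernel (t : R) : `[0, 1]%classic t -> measurable_fun (`[0, 1] : set R) (K t).
Proof.
move=> t01.
apply: (@measurable_comp _ _ _ _ _ _ _ (fun p : R * R => K p.1 p.2) _
  (fun r => (t, r)) _ _ K_measurable).
- by apply: measurableX.
- by move=> _ [r r01 <-].
- exact: measurable_funTS (pair1_measurable t).
Qed.

Lemma sqr_integrable (f : R -> R) : measurable_fun (`[0, 1] : set R) f ->
  (\int[mu]_(r in `[0%R, 1%R]) ((f r) ^+ 2)%:E < +oo)%E ->
  mu.-integrable `[0, 1] (EFin \o (fun r => (f r) ^+ 2)).
Proof.
move=> mf f2; apply/integrableP; split.
  by apply/measurable_EFinP; exact: measurable_funX.
under eq_integral do rewrite /= ger0_norm ?sqr_ge0//.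
exact: f2.
Qed.

(** On a space of mass 1 the estimate is Cauchy-Schwarz; the pointwise bound [fg] used for it also
    dominates |f| and so yields integrability. *)
Lemma norm_le_sqr (f : R -> R) (e : R) : 0 < e -> measurable_fun (`[0, 1] : set R) f ->
  (\int[mu]_(r in `[0%R, 1%R]) ((f r) ^+ 2)%:E <= (e ^+ 2)%:E)%E ->
  mu.-integrable `[0, 1] (EFin \o f) /\ \int[mu]_(r in `[0, 1]) `|f r| <= e.
Proof.
move=> e0 mf fe.
have f2 := sqr_integrable mf (le_lt_trans fe (ltry _)).
have m01 : measurable (`[0, 1]%classic : set (measurableTypeR R)) by exact: measurable_itv.
have c1 : (mu (`[0%R, 1%R]%classic : set R) < +oo)%E by rewrite mu01 ltry.
have [gi gE] := Rintegral_affine (2 * e)^-1 (- (e / 2)) m01 c1 f2.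
(* AM-GM *)
have fg r : `|f r| <= (2 * e)^-1 * f r ^+ 2 - - (e / 2).
  have : 0 <= (2 * e)^-1 * (`|f r| - e) ^+ 2 by rewrite mulr_ge0 ?sqr_ge0// invr_ge0 mulr_ge0// ltW.
  rewrite sqrrB real_normK ?num_real// => h.
  rewrite -subr_ge0; apply: le_trans h _; rewrite le_eqVlt; apply/orP; left; apply/eqP.
  by field; rewrite gt_eqF.
have fi : mu.-integrable `[0, 1] (EFin \o f).
  apply: le_integrable gi => //; first exact/measurable_EFinP.
  by move=> r _; rewrite /= lee_fin; apply: le_trans (fg r) (ler_norm _).
split => //; apply: le_trans.
  apply: le_Rintegral gi (fun r _ => fg r) => //.
  exact: integrable_norm.
have mu1 : fine (mu (`[0, 1]%classic : set R)) = 1 by rewrite mu01.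
rewrite [leLHS]gE mu1 mulr1.
have : \int[mu]_(r in `[0, 1]) (f r ^+ 2) <= e ^+ 2.
  by rewrite -lee_fin /Rintegral fineK// integrable_fin_num.
move: (\int[mu]_(r in _) _) => x xe.
have : (2 * e)^-1 * x <= (2 * e)^-1 * e ^+ 2 by rewrite ler_wpM2l// invr_ge0 mulr_ge0// ltW.
have -> : (2 * e)^-1 * e ^+ 2 = e / 2 by field; rewrite gt_eqF.
lra.
Qed.

(** Only increments are bounded by hypothesis; the vanishing of [K 0] turns the increment from 0 to
    [t] into a bound on [K t] itself. *)
Lemma kernel_integrable (t : R) : `[0, 1]%classic t -> mu.-integrable `[0, 1] (EFin \o K t).
Proof.
move=> t01; move: (t01); rewrite /= in_itv/= => /andP[]; rewrite le_eqVlt => /orP[/eqP <- _|t0 t1].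
  apply: (eq_integrable _ (EFin \o cst 0)) => //.
    by move=> r; rewrite inE => r01 /=; rewrite K_zero.
  apply: (@bounded_integrable _ _ _ mu _ _ 0) => //; first by rewrite [X in (X < _)%E]mu01 ltry.
  by move=> r _; rewrite normr0.
have := K_increments (lexx 0) t0 t1.
set b := _ `^ _ => Kb.
(* The [+ 1] keeps the radius positive even if [b = 0]. *)
have [] // := @norm_le_sqr (K t) (Num.sqrt (b + 1)).
- by rewrite sqrtr_gt0 ltr_wpDl// powR_ge0.
- exact: measurable_kernel.
rewrite sqr_sqrtr ?addr_ge0 ?powR_ge0//.
apply: le_trans (le_trans Kb _); last by rewrite lee_fin lerDl.
rewrite le_eqVlt; apply/orP; left; apply/eqP; apply: eq_integral => r.
by rewrite inE => r01; rewrite K_zero// subr0.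
Qed.

Lemma kernel_modulus (e t : R) : 0 < e -> `[0, 1]%classic t -> \forall s \near t,
  `[0, 1]%classic s -> \int[mu]_(r in `[0, 1]) `|K s r - K t r| <= e.
Proof.
move=> e0 t01.
(* Chosen so that its power of exponent [alpha] is [e ^+ 2], the bound that [norm_le_sqr] takes. *)
pose eta := (e ^+ 2) `^ alpha^-1.
have eta0 : 0 < eta by rewrite powR_gt0// exprn_gt0.
have key s u : `[0, 1]%classic s -> `[0, 1]%classic u -> s < u -> calG u - calG s <= eta ->
    \int[mu]_(r in `[0, 1]) `|K u r - K s r| <= e.
  move=> s01 u01 su Gsu.
  have mD : measurable_fun (`[0, 1] : set R) (fun r => K u r - K s r).
    by apply: measurable_funB; exact: measurable_kernel.
  apply: (norm_le_sqr e0 mD _).2.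
  have /andP[s0 _] : 0 <= s <= 1 by move: s01; rewrite /= in_itv.
  have /andP[_ u1] : 0 <= u <= 1 by move: u01; rewrite /= in_itv.
  apply: le_trans (K_increments s0 su u1) _; rewrite lee_fin.
  have -> : e ^+ 2 = eta `^ alpha.
    by rewrite -powRrM mulVf ?gt_eqF// powRr1// sqr_ge0.
  apply: ge0_ler_powR => //; rewrite ?nnegrE ?subr_ge0; try exact: ltW.
  by apply/ltW/calG_increasing.
have /subspace_continuousP/(_ t t01) := calG_continuous.
move/cvgrPdist_le => /(_ _ eta0); rewrite near_withinE; apply: filterS => s Hs s01.
have := Hs s01; rewrite ler_norml => /andP[H1 H2].
have [st|ts|<-] := ltgtP s t.
- under eq_Rintegral do rewrite distrC.
  by apply: key => //; lra.
- by apply: key => //; rewrite -lerN2 opprB.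
- under eq_Rintegral do rewrite subrr normr0.
  by rewrite /Rintegral integral0 ltW.
Qed.

End kernel_increments.

Theorem theorem2p1 (R : realType) (d : measure_display) (T : measurableType d)
    (P : probability T R) (N : R -> T -> nat)
    (HN : standard_poisson_process P N)
    (K : R -> R -> R)
    (K_measurable : measurable_fun ((`[0, 1] : set R) `*` (`[0, 1] : set R))
                      (fun p : R * R => K p.1 p.2))
    (K_zero : forall r : R, r \in `[0, 1] -> K 0 r = 0)
    (calG : R -> R) (alpha : R)
    (calG_increasing : {in `[0, 1] &, {homo calG : s t / s < t}})
    (calG_continuous : {within `[0, 1], continuous calG})
    (alpha_gt0 : 0 < alpha)
    (K_increments : forall s t : R, 0 <= s -> s < t -> t <= 1 ->
      (\int[lebesgue_measure]_(r in `[0%R, 1%R]) ((K t r - K s r) ^+ 2)%:E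
         <= ((calG t - calG s) `^ alpha)%:E)%E) :
  exists Z : R -> T -> C01 R,
    (forall eps : R, 0 < eps ->
       forall (w : T) (t : set_type (`[0, 1]%classic : set R)),
         Z eps w t = eps * G_process K N eps (\val t) w) /\
    large_deviation_principle P Z (fun eps : R => eps ^+ 2) (rate_I K).
Proof.
pose K_int := kernel_integrable K_measurable K_zero K_increments.
pose K_mod := kernel_modulus K_measurable calG_increasing calG_continuous alpha_gt0
  K_increments.
exists (scaled_process HN K_int K_mod); split; first exact: scaled_process_spec.
split.
- by split; [exact: rate_I_lsc|exact: rate_I_ge0].
- by move=> eps e0 A; exact: measurable_scaled_process.
- move=> A bA; split.
  + exact: ldp_lower_bound.
  + exact: limf_einf_le_esup.
  + exact: ldp_upper_bound.
Qed.
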